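(* Let $\widetilde\Gamma(x)=\frac1x e^{x\log 2}\prod_{k=1}^\infty\left(e^{-x/k}(1+x/k)\right)^{(-1)^{k+1}}$, a meromorphic function on $\mathbb{C}$. For $n\in\mathbb{N}$: (1) $\widetilde\Gamma(n)=\frac{(n-2)!!}{(n-1)!!}$ if $n$ is even, and $\widetilde\Gamma(n)=\frac{(n-2)!!}{(n-1)!!}\cdot\frac\pi2$ if $n$ is odd; (2) $\widetilde\Gamma(-n)=\infty$ (i.e. $\widetilde\Gamma$ has a pole at $-n$) if $n$ is even, and $\widetilde\Gamma(-n)=0$ if $n$ is odd.
   Context: In the product defining $\widetilde\Gamma$, for odd $k$ the factor is $e^{-x/k}(1+x/k)$ and for even $k$ it is its reciprocal. $m!!$ is the double factorial, with the conventions $0!!=(-1)!!=1$. $\mathbb{N}=\{1,2,3,\dots\}$. *)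

(* Defs.v *)
From Stdlib Require Import Reals ZArith Arith.
From Coquelicot Require Import Coquelicot.

Open Scope C_scope.

Definition Cexp (z : C) : C :=
  (exp (Re z) * cos (Im z), exp (Re z) * sin (Im z))%R.

(* Limit of a complex sequence; only meaningful when [u] converges, in the same
   way as [Lim_seq] and [C_lim]. *)
Definition Clim_seq (u : nat -> C) : C :=
  (real (Lim_seq (fun N => Re (u N))), real (Lim_seq (fun N => Im (u N)))).

(* u 1 * u 2 * ... * u N *)
Fixpoint Cprod (u : nat -> C) (N : nat) : C :=
  match N with
  | O => 1
  | S M => Cprod u M * u (S M)
  end.

(* Convergence of the partial products to a limit, which may be 0, as it must
   be when a factor vanishes. *)
Definition Cprod_converges (u : nat -> C) : Prop :=
  exists l : C, filterlim (Cprod u) eventually (locally l).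

(* (e^{-x/k} (1 + x/k))^{(-1)^{k+1}} *)
Definition Gamma_factor (x : C) (k : nat) : C :=
  let f := Cexp (- (x / INR k)) * (1 + x / INR k) in
  if Nat.odd k then f else / f.

(* Since [/ 0 = 0] in Coquelicot, the values at 0 and at the negative even
   integers are not meaningful; there, [has_pole] only looks at a punctured
   neighbourhood. *)
Definition GammaTilde (x : C) : C :=
  1 / x * Cexp (x * ln 2) * Clim_seq (Cprod (Gamma_factor x)).

Definition C_differentiable (f : C -> C) (z : C) : Prop :=
  @ex_derive C_AbsRing C_NormedModule f z.

Definition holomorphic_at (f : C -> C) (a : C) : Prop :=
  locally a (C_differentiable f).

(* An isolated singularity at which |f| tends to infinity. *)
Definition has_pole (f : C -> C) (a : C) : Prop :=
  locally' a (C_differentiable f) /\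
  filterlim (fun z => Cmod (f z)) (locally' a) (Rbar_locally p_infty).

(* On the whole plane; the value of [f] at a pole is irrelevant. *)
Definition meromorphic (f : C -> C) : Prop :=
  forall a : C, holomorphic_at f a \/ has_pole f a.

Fixpoint double_fact (m : nat) : nat :=
  match m with
  | S (S p) => m * double_fact p
  | _ => 1
  end.

(* [Z.to_nat (-1) = 0], hence (-1)!! = 0!! = 1. *)
Definition double_factZ (m : Z) : R := INR (double_fact (Z.to_nat m)).

(* Main.v *)
(* The factors of index 2j-1 and 2j, stripped of their exponentials, multiply to
   1 + x/((2j-1)(x+2j)), while the exponentials multiply to exp(-x ln 2) since
   1 - 1/2 + 1/3 - ... = ln 2.  Hence GammaTilde(x) = (1/x) prod_j (1 +
   x/((2j-1)(x+2j))), a product that converges locally uniformly.  On a disc, the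
   factors with large j have sup norm, Lipschitz constant and second-order Taylor
   remainder of size O(1/j^2); this C^{1,1} size is submultiplicative up to a
   constant, so it stays bounded along the partial products and the tail of the
   product is differentiable, without any appeal to Cauchy's integral formula.
   The tail does not vanish, so the poles and zeros are those of the remaining
   rational function.

   At positive integers the product satisfies GammaTilde(x+2) =
   x/(x+1) GammaTilde(x); it telescopes to GammaTilde(2) = 1, and
   GammaTilde(1) = pi/2 is the Wallis product. *)

Require Import Defs.
From Stdlib Require Import Reals ZArith Arith Lra Lia.
From Coquelicot Require Import Coquelicot.

Open Scope C_scope.

(** * Holomorphic functions and poles *)

Lemma Cplus_eq_0_opp (z b : C) : z + b = 0 -> z = - b.
Proof. intros E. replace z with (z + b - b) by ring. rewrite E. ring. Qed.

Lemma Cinv_neq_0 (z : C) : z <> 0 -> / z <> 0.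
Proof.
  intros Hz. apply Cmod_gt_0. rewrite Cmod_inv by easy.
  now apply Rinv_0_lt_compat, Cmod_gt_0.
Qed.

(** The balls of [C] as a product uniform space are squares; they compare with discs up to a factor
    [sqrt 2]. *)
Lemma locally_Cmod (a : C) (P : C -> Prop) :
  locally a P <->
  exists d : R, (0 < d)%R /\ forall z, (Cmod (z - a) < d)%R -> P z.
Proof.
  split.
  - intros [d Hd]. exists d; split; [apply cond_pos|].
    intros z Hz. apply Hd. now apply C_NormedModule_mixin_compat1.
  - intros [d [Hd H]].
    assert (Hs : (0 < sqrt 2)%R) by (apply sqrt_lt_R0; lra).
    assert (He : (0 < d / sqrt 2)%R) by (apply Rdiv_lt_0_compat; lra).
    exists (mkposreal _ He). intros z Hz. apply H.
    apply C_NormedModule_mixin_compat2 in Hz. simpl in Hz.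
    replace (sqrt 2 * (d / sqrt 2))%R with d in Hz by (field; lra). exact Hz.
Qed.

(** [ex_derive] filters along the uniform structure of [C_AbsRing], while [locally] elsewhere uses
    the product structure; [locally_C] identifies their neighbourhoods. *)
Lemma C_differentiable_eps (f : C -> C) (z : C) :
  C_differentiable f z <->
  exists l : C, forall eps : R, (0 < eps)%R ->
    locally z (fun w =>
      (Cmod (f w - f z - (w - z) * l) <= eps * Cmod (w - z))%R).
Proof.
  split.
  - intros [l [_ H]]. exists l. intros eps He.
    specialize (H z (fun P HP => HP) (mkposreal _ He)).
    apply locally_C in H. exact H.
  - intros [l H]. exists l. split.
    + apply is_linear_scal_l.
    + intros x Hx eps.
      assert (z = x) as <-.
      { exact (is_filter_lim_locally_unique
                 (V := AbsRing_NormedModule C_AbsRing) z x Hx). }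
      apply locally_C. apply (H eps (cond_pos eps)).
Qed.

Lemma C_differentiable_continuous (f : C -> C) (z : C) :
  C_differentiable f z ->
  forall eps : R, (0 < eps)%R ->
    locally z (fun w => (Cmod (f w - f z) < eps)%R).
Proof.
  intros Hf eps He.
  apply C_differentiable_eps in Hf. destruct Hf as [l Hl].
  specialize (Hl 1%R Rlt_0_1). apply locally_Cmod in Hl.
  destruct Hl as [d [Hd H]].
  apply locally_Cmod.
  (* Error bound 1 in the definition of the derivative makes [f] Lipschitz at [z] with constant
     [1 + Cmod l]. *)
  set (K := (1 + Cmod l)%R).
  assert (HK : (0 < K)%R) by (unfold K; pose proof (Cmod_ge_0 l); lra).
  exists (Rmin d (eps / K)). split.
  { apply Rmin_pos; [easy|]. now apply Rdiv_lt_0_compat. }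
  intros w Hw.
  assert (H1 := Rlt_le_trans _ _ _ Hw (Rmin_l _ _)).
  assert (H2 := Rlt_le_trans _ _ _ Hw (Rmin_r _ _)).
  specialize (H w H1).
  replace (f w - f z) with ((f w - f z - (w - z) * l) + (w - z) * l) by ring.
  eapply Rle_lt_trans; [apply Cmod_triangle|]. rewrite Cmod_mult.
  apply Rle_lt_trans with (Cmod (w - z) * K)%R; [unfold K; nra|].
  apply Rmult_lt_reg_r with (/ K)%R; [now apply Rinv_0_lt_compat|].
  rewrite Rmult_assoc, Rinv_r, Rmult_1_r by lra. exact H2.
Qed.

Lemma C_differentiable_ext (f g : C -> C) (z : C) :
  locally z (fun w => f w = g w) -> C_differentiable f z ->
  C_differentiable g z.
Proof.
  intros He Hf. apply C_differentiable_eps in Hf. destruct Hf as [l Hl].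
  apply C_differentiable_eps. exists l. intros eps Heps.
  assert (E := locally_singleton _ _ He). simpl in E.
  generalize (filter_and _ _ He (Hl eps Heps)).
  apply filter_imp. intros w [<- H]. now rewrite <- E.
Qed.

Lemma C_differentiable_affine (p q z : C) :
  C_differentiable (fun w => p + q * w) z.
Proof.
  apply C_differentiable_eps. exists q. intros eps He.
  apply filter_forall. intros w.
  replace (p + q * w - (p + q * z) - (w - z) * q) with (RtoC 0) by ring.
  rewrite Cmod_0. apply Rmult_le_pos; [lra|apply Cmod_ge_0].
Qed.

Lemma C_differentiable_mult (f g : C -> C) (z : C) :
  C_differentiable f z -> C_differentiable g z ->
  C_differentiable (fun w => f w * g w) z.
Proof.
  intros Hf Hg.
  assert (Cf := C_differentiable_continuous _ _ Hf).
  apply C_differentiable_eps in Hf. destruct Hf as [l Hl].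
  apply C_differentiable_eps in Hg. destruct Hg as [m Hm].
  apply C_differentiable_eps. exists (l * g z + f z * m).
  intros eps He.
  (* The three error terms below are at most [e * Cmod (w - z)] times [Cmod (g z)], [Cmod (f z)] and
     [1 + Cmod m]; the last one uses [e <= 1]. *)
  set (K := (2 + Cmod (g z) + Cmod (f z) + Cmod m)%R).
  pose proof (Cmod_ge_0 (g z)). pose proof (Cmod_ge_0 (f z)).
  pose proof (Cmod_ge_0 m).
  assert (HK : (0 < K)%R) by (unfold K; lra).
  set (e := Rmin 1 (eps / K)).
  assert (He' : (0 < e)%R).
  { apply Rmin_pos; [lra|]. now apply Rdiv_lt_0_compat. }
  assert (He1 : (e <= 1)%R) by apply Rmin_l.
  assert (He2 : (e * K <= eps)%R).
  { apply Rle_trans with (eps / K * K)%R; [|right; field; lra].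
    apply Rmult_le_compat_r; [lra|apply Rmin_r]. }
  generalize (filter_and _ _ (Cf e He') (filter_and _ _ (Hl e He') (Hm e He'))).
  apply filter_imp. intros w [E1 [E2 E3]].
  replace (f w * g w - f z * g z - (w - z) * (l * g z + f z * m)) with
    ((f w - f z - (w - z) * l) * g z + f z * (g w - g z - (w - z) * m)
     + (f w - f z) * ((g w - g z - (w - z) * m) + (w - z) * m)) by ring.
  pose proof (Cmod_ge_0 (w - z)).
  pose proof (Cmod_ge_0 (f w - f z)).
  pose proof (Cmod_ge_0 (f w - f z - (w - z) * l)).
  pose proof (Cmod_ge_0 (g w - g z - (w - z) * m)).
  eapply Rle_trans; [apply Cmod_triangle|]. rewrite Cmod_mult.
  eapply Rle_trans.
  { apply Rplus_le_compat; [apply Cmod_triangle|].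
    apply Rmult_le_compat_l; [easy|]. apply Cmod_triangle. }
  rewrite !Cmod_mult.
  apply Rle_trans with (e * K * Cmod (w - z))%R; [|now apply Rmult_le_compat_r].
  set (h := Cmod (w - z)) in *.
  assert (Cmod (f w - f z - (w - z) * l) * Cmod (g z) <= e * h * Cmod (g z))%R
    by now apply Rmult_le_compat_r.
  assert (Cmod (f z) * Cmod (g w - g z - (w - z) * m) <= Cmod (f z) * (e * h))%R
    by now apply Rmult_le_compat_l.
  assert (Cmod (f w - f z) * (Cmod (g w - g z - (w - z) * m) + h * Cmod m)
      <= e * (h + h * Cmod m))%R.
  { apply Rmult_le_compat; [easy| |lra|].
    - apply Rplus_le_le_0_compat; [easy|now apply Rmult_le_pos].
    - apply Rplus_le_compat_r. nra. }
  assert (0 <= e * h)%R by (apply Rmult_le_pos; lra).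
  unfold K. nra.
Qed.

Lemma C_differentiable_inv_shift (b z : C) :
  z + b <> 0 -> C_differentiable (fun w => / (w + b)) z.
Proof.
  intros Hz. apply C_differentiable_eps. exists (- / ((z + b) * (z + b))).
  intros eps He. apply locally_Cmod.
  set (r := Cmod (z + b)).
  assert (Hr : (0 < r)%R) by now apply Cmod_gt_0.
  (* The first bound keeps [Cmod (w + b) >= r / 2]. The remainder, of modulus
     [|w - z|^2 / (|w + b| r^2)], is then at most [2 |w - z|^2 / r^3], which the second bound
     controls. *)
  exists (Rmin (r / 2) (eps * (r * r * r) / 2)). split.
  { apply Rmin_pos; [lra|]. repeat apply Rmult_lt_0_compat; lra. }
  intros w Hw.
  assert (H1 := Rlt_le_trans _ _ _ Hw (Rmin_l _ _)).
  assert (H2 := Rlt_le_trans _ _ _ Hw (Rmin_r _ _)).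
  assert (H3 : (r / 2 <= Cmod (w + b))%R).
  { pose proof (Cmod_triangle (w + b) (- (w - z))) as T.
    rewrite Cmod_opp in T.
    replace (w + b + - (w - z)) with (z + b) in T by ring. fold r in T. lra. }
  assert (Hwb : w + b <> 0) by (apply Cmod_gt_0; lra).
  replace (/ (w + b) - / (z + b) - (w - z) * - / ((z + b) * (z + b))) with
    ((w - z) * ((w - z) * / ((w + b) * ((z + b) * (z + b))))) by (field; auto).
  rewrite !Cmod_mult, Cmod_inv by (repeat apply Cmult_neq_0; auto).
  rewrite !Cmod_mult. fold r.
  rewrite Rmult_comm. apply Rmult_le_compat_r; [apply Cmod_ge_0|].
  apply Rmult_le_reg_r with (Cmod (w + b) * (r * r))%R.
  { repeat apply Rmult_lt_0_compat; lra. }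
  rewrite Rmult_assoc, Rinv_l.
  2:{ apply Rgt_not_eq. repeat apply Rmult_lt_0_compat; lra. }
  assert (0 < r * r)%R by nra.
  apply Rle_trans with (eps * (r / 2 * (r * r)))%R; [nra|].
  apply Rmult_le_compat_l; [lra|]. apply Rmult_le_compat_r; lra.
Qed.

Lemma holomorphic_at_mult (f g : C -> C) (a : C) :
  holomorphic_at f a -> holomorphic_at g a ->
  holomorphic_at (fun w => f w * g w) a.
Proof.
  unfold holomorphic_at.
  intros Hf Hg. generalize (filter_and _ _ Hf Hg).
  apply filter_imp. intros z [H1 H2]. now apply C_differentiable_mult.
Qed.

Lemma holomorphic_at_affine (p q a : C) :
  holomorphic_at (fun w => p + q * w) a.
Proof.
  unfold holomorphic_at. apply filter_forall. intros z. apply C_differentiable_affine.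
Qed.

Lemma locally_neq (a b : C) : a <> b -> locally a (fun z => z <> b).
Proof.
  intros H. apply locally_Cmod. exists (Cmod (b - a)). split.
  - apply Cmod_gt_0. intros E. apply H.
    replace a with (b - (b - a)) by ring. rewrite E. ring.
  - intros z Hz ->. lra.
Qed.

Lemma holomorphic_at_inv_shift (b a : C) :
  a <> - b -> holomorphic_at (fun w => / (w + b)) a.
Proof.
  unfold holomorphic_at.
  intros H. generalize (locally_neq _ _ H). apply filter_imp.
  intros z Hz. apply C_differentiable_inv_shift. intros E. apply Hz.
  now apply Cplus_eq_0_opp.
Qed.

Lemma holomorphic_at_ext (f g : C -> C) (a : C) :
  locally a (fun z => f z = g z) -> holomorphic_at f a -> holomorphic_at g a.
Proof.
  unfold holomorphic_at.
  intros He Hf. generalize (filter_and _ _ (locally_locally _ _ He) Hf).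
  apply filter_imp. intros z [H1 H2]. now apply C_differentiable_ext with f.
Qed.

Lemma locally'_of_locally (a : C) (P : C -> Prop) :
  locally a P -> locally' a P.
Proof. intros H. unfold locally', within. revert H. now apply filter_imp. Qed.

(** Around a point other than [a], a small neighbourhood avoids [a]. This lets an equality known
    only off [a] transport differentiability at nearby points. *)
Lemma locally'_locally (a : C) (P : C -> Prop) :
  locally' a P -> locally' a (fun z => locally z P).
Proof.
  intros H. unfold locally', within in *.
  generalize (locally_locally _ _ H). apply filter_imp.
  intros z Hz Hza. generalize (filter_and _ _ Hz (locally_neq _ _ Hza)).
  apply filter_imp. intros w [H1 H2]. auto.
Qed.

Lemma has_pole_ext (f g : C -> C) (a : C) :
  locally' a (fun z => f z = g z) -> has_pole f a -> has_pole g a.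
Proof.
  intros He [H1 H2]. split.
  - generalize (filter_and _ _ (locally'_locally _ _ He) H1).
    apply filter_imp. intros z [E1 E2]. now apply C_differentiable_ext with f.
  - eapply filterlim_ext_loc; [|exact H2].
    revert He. apply filter_imp. now intros z ->.
Qed.

Lemma has_pole_inv_shift (b : C) : has_pole (fun w => / (w + b)) (- b).
Proof.
  split.
  - unfold locally', within. apply filter_forall. intros z Hz.
    apply C_differentiable_inv_shift.
    intros E. apply Hz. now apply Cplus_eq_0_opp.
  - intros P [M HM]. unfold filtermap, locally', within. apply locally_Cmod.
    pose proof (Rabs_pos M) as HM0.
    exists (/ (Rabs M + 1))%R. split; [apply Rinv_0_lt_compat; lra|].
    intros z Hz Hne. apply HM.
    assert (Hzb : z + b <> 0).
    { intros E. apply Hne. now apply Cplus_eq_0_opp. }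
    rewrite Cmod_inv by easy.
    replace (z - - b) with (z + b) in Hz by ring.
    assert (H0 : (0 < Cmod (z + b))%R) by now apply Cmod_gt_0.
    apply Rinv_lt_contravar in Hz.
    2:{ apply Rmult_lt_0_compat; [easy|]. apply Rinv_0_lt_compat; lra. }
    rewrite Rinv_inv in Hz. pose proof (Rle_abs M). lra.
Qed.

Lemma has_pole_mult (f g : C -> C) (a : C) :
  has_pole f a -> holomorphic_at g a -> g a <> 0 ->
  has_pole (fun w => f w * g w) a.
Proof.
  intros [H1 H2] Hg Hga. split.
  - assert (Hg' : locally' a (C_differentiable g)).
    { now apply locally'_of_locally. }
    generalize (filter_and _ _ H1 Hg'). apply filter_imp.
    intros z [E1 E2]. now apply C_differentiable_mult.
  - intros P [M HM].
    set (r := Cmod (g a)).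
    assert (Hr : (0 < r)%R) by now apply Cmod_gt_0.
    assert (Hc : locally' a (fun w => (Cmod (g w - g a) < r / 2)%R)).
    { apply locally'_of_locally.
      apply C_differentiable_continuous; [|lra]. now apply locally_singleton. }
    (* Near [a], continuity gives [Cmod (g z) >= r / 2], and [K * (r / 2) = Rabs M + 1] exceeds
       [M]. *)
    set (K := (2 * (Rabs M + 1) / r)%R).
    assert (HK : Rbar_locally p_infty (fun y => (K < y)%R)) by now exists K.
    unfold filtermap. generalize (filter_and _ _ Hc (H2 _ HK)).
    apply filter_imp. intros z [E1 E2]. apply HM. rewrite Cmod_mult.
    assert (E3 : (r / 2 <= Cmod (g z))%R).
    { pose proof (Cmod_triangle (g z) (- (g z - g a))) as T.
      rewrite Cmod_opp in T.
      replace (g z + - (g z - g a)) with (g a) in T by ring. fold r in T. lra. }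
    pose proof (Rle_abs M). pose proof (Rabs_pos M).
    apply Rlt_le_trans with (K * (r / 2))%R.
    { unfold K. replace (2 * (Rabs M + 1) / r * (r / 2))%R with (Rabs M + 1)%R
        by (field; lra). lra. }
    apply Rmult_le_compat; try lra.
    unfold K. apply Rmult_le_pos; [lra|]. left. now apply Rinv_0_lt_compat.
Qed.

(** * Complex sequences *)

(** The componentwise form evaluates [Clim_seq] directly and reduces limits to real ones. *)
Definition Ccv (u : nat -> C) (l : C) : Prop :=
  is_lim_seq (fun n => Re (u n)) (Re l) /\
  is_lim_seq (fun n => Im (u n)) (Im l).

Lemma Ccv_Clim_seq (u : nat -> C) (l : C) : Ccv u l -> Clim_seq u = l.
Proof.
  intros [H1 H2]. unfold Clim_seq.
  rewrite (is_lim_seq_unique _ _ H1), (is_lim_seq_unique _ _ H2).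
  now destruct l.
Qed.

Lemma Ccv_filterlim (u : nat -> C) (l : C) :
  Ccv u l -> filterlim u eventually (locally l).
Proof.
  intros [H1 H2]. apply filterlim_locally. intros eps.
  apply filterlim_locally with (eps := eps) in H1.
  apply filterlim_locally with (eps := eps) in H2.
  generalize (filter_and _ _ H1 H2). apply filter_imp.
  intros n [E1 E2]. now split.
Qed.

Lemma Ccv_ext_loc (u v : nat -> C) (l : C) :
  eventually (fun n => u n = v n) -> Ccv u l -> Ccv v l.
Proof.
  intros He [H1 H2]. split; (eapply is_lim_seq_ext_loc; [|eassumption]);
    revert He; apply filter_imp; now intros n ->.
Qed.

Lemma Ccv_ext (u v : nat -> C) (l : C) :
  (forall n, u n = v n) -> Ccv u l -> Ccv v l.
Proof. intros H. apply Ccv_ext_loc. exists O. auto. Qed.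

Lemma Ccv_const (a : C) : Ccv (fun _ => a) a.
Proof. split; apply is_lim_seq_const. Qed.

Lemma Ccv_RtoC (u : nat -> R) (l : R) :
  is_lim_seq u l -> Ccv (fun n => RtoC (u n)) (RtoC l).
Proof. intros H. split; [exact H|apply is_lim_seq_const]. Qed.

Lemma Ccv_minus (u v : nat -> C) (l m : C) :
  Ccv u l -> Ccv v m -> Ccv (fun n => u n - v n) (l - m).
Proof.
  intros [H1 H2] [H3 H4]. split; simpl.
  - apply (is_lim_seq_minus' _ _ _ _ H1 H3).
  - apply (is_lim_seq_minus' _ _ _ _ H2 H4).
Qed.

Lemma Ccv_mult (u v : nat -> C) (l m : C) :
  Ccv u l -> Ccv v m -> Ccv (fun n => u n * v n) (l * m).
Proof.
  intros [H1 H2] [H3 H4]. split; simpl.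
  - apply (is_lim_seq_minus' _ _ _ _ (is_lim_seq_mult' _ _ _ _ H1 H3)
             (is_lim_seq_mult' _ _ _ _ H2 H4)).
  - apply (is_lim_seq_plus' _ _ _ _ (is_lim_seq_mult' _ _ _ _ H1 H4)
             (is_lim_seq_mult' _ _ _ _ H2 H3)).
Qed.

Lemma Ccv_Cmod (u : nat -> C) (l : C) :
  Ccv u l -> is_lim_seq (fun n => Cmod (u n)) (Cmod l).
Proof.
  intros [H1 H2]. unfold Cmod.
  apply is_lim_seq_continuous with
    (f := sqrt) (u := fun n => (fst (u n) ^ 2 + snd (u n) ^ 2)%R).
  - apply continuity_pt_sqrt. nra.
  - simpl. apply is_lim_seq_plus'; apply is_lim_seq_mult'; try easy;
      apply is_lim_seq_mult'; try easy; apply is_lim_seq_const.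
Qed.

Lemma Ccv_Cmod_le (u : nat -> C) (l : C) (M : R) :
  Ccv u l -> (forall n, (Cmod (u n) <= M)%R) -> (Cmod l <= M)%R.
Proof.
  intros H HM.
  exact (is_lim_seq_le _ (fun _ => M) (Finite _) (Finite _) HM (Ccv_Cmod _ _ H)
           (is_lim_seq_const M)).
Qed.

(** * The complex exponential *)

Lemma Cexp_plus (z w : C) : Cexp (z + w) = Cexp z * Cexp w.
Proof.
  unfold Cexp, Cmult. apply injective_projections; simpl;
    rewrite exp_plus, ?cos_plus, ?sin_plus; unfold Re, Im; ring.
Qed.

Lemma Cexp_0 : Cexp 0 = 1.
Proof.
  unfold Cexp. simpl. rewrite exp_0, cos_0, sin_0.
  apply injective_projections; simpl; ring.
Qed.

Lemma Cexp_mult_opp (z : C) : Cexp z * Cexp (- z) = 1.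
Proof. rewrite <- Cexp_plus, Cplus_opp_r. apply Cexp_0. Qed.

Lemma Cexp_neq_0 (z : C) : Cexp z <> 0.
Proof.
  intros H. apply C1_nz.
  now rewrite <- (Cexp_mult_opp z), H, Cmult_0_l.
Qed.

Lemma Cexp_opp (z : C) : Cexp (- z) = / Cexp z.
Proof.
  rewrite <- (Cmult_1_r (/ Cexp z)), <- (Cexp_mult_opp z).
  field. apply Cexp_neq_0.
Qed.

Lemma Ccv_Cexp (u : nat -> C) (l : C) :
  Ccv u l -> Ccv (fun n => Cexp (u n)) (Cexp l).
Proof.
  intros [H1 H2].
  assert (E : is_lim_seq (fun n => exp (Re (u n))) (exp (Re l))).
  { apply is_lim_seq_continuous; [|easy].
    apply derivable_continuous_pt, derivable_pt_exp. }
  split; simpl; apply is_lim_seq_mult'; try easy;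
    apply is_lim_seq_continuous; try easy.
  - apply continuity_cos.
  - apply continuity_sin.
Qed.

(** * Convergence criteria: splitting by parity and telescoping bounds *)

Lemma is_lim_seq_even_odd (u : nat -> R) (l : R) :
  is_lim_seq (fun n => u (2 * n)%nat) l ->
  is_lim_seq (fun n => u (2 * n + 1)%nat) l -> is_lim_seq u l.
Proof.
  intros H1 H2. apply is_lim_seq_spec. intros eps.
  apply is_lim_seq_spec in H1. apply is_lim_seq_spec in H2.
  destruct (H1 eps) as [N1 E1]. destruct (H2 eps) as [N2 E2].
  exists (2 * N1 + 2 * N2 + 1)%nat. intros n Hn.
  destruct (Nat.Even_or_Odd n) as [[m ->]|[m ->]]; [apply E1|apply E2]; lia.
Qed.

Lemma Ccv_even_odd (u : nat -> C) (l : C) :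
  Ccv (fun n => u (2 * n)%nat) l -> Ccv (fun n => u (2 * n + 1)%nat) l ->
  Ccv u l.
Proof. intros [] []. split; now apply is_lim_seq_even_odd. Qed.

(** The sequence [u - d] is nondecreasing, and it is bounded above because [u + d] is nonincreasing
    and [d] nonnegative. As [d] converges too, so does [u = (u - d) + d]. *)
Lemma ex_finite_lim_seq_telescope (u d : nat -> R) :
  (forall n, (0 <= d n)%R) ->
  (forall n, (Rabs (u (S n) - u n) <= d n - d (S n))%R) ->
  ex_finite_lim_seq u.
Proof.
  intros Hd Hu.
  assert (Hdd : forall n, (d (S n) <= d n)%R).
  { intros n. pose proof (Rabs_pos (u (S n) - u n)). specialize (Hu n). lra. }
  assert (B : forall n, (u n + d n <= u O + d O)%R).
  { induction n; [lra|]. specialize (Hu n). apply Rabs_le_between in Hu. lra. }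
  destruct (ex_finite_lim_seq_decr d 0 Hdd Hd) as [ld Hld].
  destruct (ex_finite_lim_seq_incr (fun n => u n - d n)%R (u O + d O)%R)
    as [lv Hlv].
  - intros n. specialize (Hu n). apply Rabs_le_between in Hu. lra.
  - intros n. specialize (B n). specialize (Hd n). lra.
  - exists (lv + ld)%R.
    apply is_lim_seq_ext with (fun n => (u n - d n) + d n)%R; [intros; ring|].
    now apply is_lim_seq_plus'.
Qed.

Lemma Ccv_telescope (u : nat -> C) (d : nat -> R) :
  (forall n, (0 <= d n)%R) ->
  (forall n, (Cmod (u (S n) - u n) <= d n - d (S n))%R) ->
  Ccv u (Clim_seq u).
Proof.
  intros Hd Hu.
  destruct (ex_finite_lim_seq_telescope (fun n => Re (u n)) d Hd) as [a Ha].
  { intros n. eapply Rle_trans; [|apply Hu].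
    eapply Rle_trans; [|apply Rmax_Cmod]. apply Rmax_l. }
  destruct (ex_finite_lim_seq_telescope (fun n => Im (u n)) d Hd) as [b Hb].
  { intros n. eapply Rle_trans; [|apply Hu].
    eapply Rle_trans; [|apply Rmax_Cmod]. apply Rmax_r. }
  assert (H : Ccv u (a, b)) by (now split).
  now rewrite (Ccv_Clim_seq _ _ H).
Qed.

(** * Quantitative differentiability on a disc *)

(* These bounds survive pointwise limits, unlike differentiability itself, and
   are stable under products. *)
Definition C11_bounded (r : R) (f f' : C -> C) (M : R) : Prop :=
  forall z w : C, (Cmod z < r)%R -> (Cmod w < r)%R ->
    (Cmod (f z) <= M)%R /\ (Cmod (f' z) <= M)%R /\
    (Cmod (f w - f z) <= M * Cmod (w - z))%R /\
    (Cmod (f w - f z - (w - z) * f' z) <= M * Cmod (w - z) ^ 2)%R.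

Lemma C11_bounded_const (r : R) (a : C) :
  C11_bounded r (fun _ => a) (fun _ => 0) (Cmod a).
Proof.
  intros z w _ _. pose proof (Cmod_ge_0 a). pose proof (Cmod_ge_0 (w - z)).
  replace (a - a - (w - z) * 0) with (RtoC 0) by ring.
  replace (a - a) with (RtoC 0) by ring. rewrite Cmod_0.
  repeat split; try lra; apply Rmult_le_pos; try easy. apply pow2_ge_0.
Qed.

Lemma C11_bounded_le (r : R) (f f' : C -> C) (M K : R) :
  (M <= K)%R -> C11_bounded r f f' M -> C11_bounded r f f' K.
Proof.
  intros HMK H z w Hz Hw. destruct (H z w Hz Hw) as (H1 & H2 & H3 & H4).
  pose proof (Cmod_ge_0 (w - z)). pose proof (pow2_ge_0 (Cmod (w - z))).
  repeat split; try lra.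
  - apply Rle_trans with (1 := H3). now apply Rmult_le_compat_r.
  - apply Rle_trans with (1 := H4). now apply Rmult_le_compat_r.
Qed.

Lemma C11_bounded_plus (r : R) (f f' g g' : C -> C) (M K : R) :
  C11_bounded r f f' M -> C11_bounded r g g' K ->
  C11_bounded r (fun z => f z + g z) (fun z => f' z + g' z) (M + K)%R.
Proof.
  intros Hf Hg z w Hz Hw.
  destruct (Hf z w Hz Hw) as (F1 & F2 & F3 & F4).
  destruct (Hg z w Hz Hw) as (G1 & G2 & G3 & G4).
  repeat split.
  - eapply Rle_trans; [apply Cmod_triangle|lra].
  - eapply Rle_trans; [apply Cmod_triangle|lra].
  - replace (f w + g w - (f z + g z)) with ((f w - f z) + (g w - g z)) by ring.
    eapply Rle_trans; [apply Cmod_triangle|lra].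
  - replace (f w + g w - (f z + g z) - (w - z) * (f' z + g' z)) with
      ((f w - f z - (w - z) * f' z) + (g w - g z - (w - z) * g' z)) by ring.
    eapply Rle_trans; [apply Cmod_triangle|lra].
Qed.

(** The constant 3 comes from the Taylor remainder, which splits into three terms of size
    [M * K * Cmod (w - z) ^ 2]; the other bounds cost at most 2. *)
Lemma C11_bounded_mult (r : R) (f f' g g' : C -> C) (M K : R) :
  C11_bounded r f f' M -> C11_bounded r g g' K ->
  C11_bounded r (fun z => f z * g z) (fun z => f' z * g z + f z * g' z)
    (3 * M * K)%R.
Proof.
  intros Hf Hg z w Hz Hw.
  destruct (Hf z w Hz Hw) as (F1 & F2 & F3 & F4).
  destruct (Hg z w Hz Hw) as (G1 & G2 & G3 & G4).
  destruct (Hg w z Hw Hz) as (G5 & _).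
  assert (0 <= M)%R by (eapply Rle_trans; [apply Cmod_ge_0|exact F1]).
  assert (0 <= K)%R by (eapply Rle_trans; [apply Cmod_ge_0|exact G1]).
  assert (0 <= M * K)%R by now apply Rmult_le_pos.
  assert (prod_le : forall (a b : C) (x y : R), (Cmod a <= x)%R ->
            (Cmod b <= y)%R -> (Cmod (a * b) <= x * y)%R).
  { intros a b x y Ha Hb. rewrite Cmod_mult.
    apply Rmult_le_compat; auto; apply Cmod_ge_0. }
  pose proof (Cmod_ge_0 (w - z)) as Hh.
  assert (0 <= Cmod (w - z) ^ 2)%R by apply pow2_ge_0.
  repeat split.
  - eapply Rle_trans; [apply prod_le; eassumption|lra].
  - eapply Rle_trans; [apply Cmod_triangle|].
    pose proof (prod_le _ _ _ _ F2 G1). pose proof (prod_le _ _ _ _ F1 G2). lra.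
  - replace (f w * g w - f z * g z) with
      ((f w - f z) * g w + f z * (g w - g z)) by ring.
    eapply Rle_trans; [apply Cmod_triangle|].
    pose proof (prod_le _ _ _ _ F3 G5). pose proof (prod_le _ _ _ _ F1 G3). nra.
  - replace (f w * g w - f z * g z - (w - z) * (f' z * g z + f z * g' z)) with
      ((f w - f z - (w - z) * f' z) * g z + f z * (g w - g z - (w - z) * g' z)
       + (f w - f z) * (g w - g z)) by ring.
    eapply Rle_trans; [apply Cmod_triangle|].
    eapply Rle_trans; [apply Rplus_le_compat_r, Cmod_triangle|].
    pose proof (prod_le _ _ _ _ F4 G1). pose proof (prod_le _ _ _ _ F1 G4).
    pose proof (prod_le _ _ _ _ F3 G3). nra.
Qed.

(** For fixed [z] and [w] each of the four bounds is a non-strict inequality, so it passes to the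
    limit when [M] is common to all [n]. *)
Lemma C11_bounded_lim (r : R) (f f' : nat -> C -> C) (F F' : C -> C) (M : R) :
  (forall n, C11_bounded r (f n) (f' n) M) ->
  (forall z, (Cmod z < r)%R -> Ccv (fun n => f n z) (F z)) ->
  (forall z, (Cmod z < r)%R -> Ccv (fun n => f' n z) (F' z)) ->
  C11_bounded r F F' M.
Proof.
  intros H HF HF' z w Hz Hw.
  repeat split.
  - apply (Ccv_Cmod_le (fun n => f n z)); [now apply HF|].
    intros n. now apply (H n z w).
  - apply (Ccv_Cmod_le (fun n => f' n z)); [now apply HF'|].
    intros n. now apply (H n z w).
  - apply (Ccv_Cmod_le (fun n => f n w - f n z)).
    + apply Ccv_minus; now apply HF.
    + intros n. now apply (H n z w).
  - apply (Ccv_Cmod_le (fun n => f n w - f n z - (w - z) * f' n z)).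
    + apply Ccv_minus; [apply Ccv_minus; now apply HF|].
      apply Ccv_mult; [apply Ccv_const|now apply HF'].
    + intros n. now apply (H n z w).
Qed.

Lemma C11_bounded_differentiable (r : R) (f f' : C -> C) (M : R) (z : C) :
  C11_bounded r f f' M -> (Cmod z < r)%R -> C_differentiable f z.
Proof.
  intros H Hz. apply C_differentiable_eps. exists (f' z). intros eps He.
  assert (HM : (0 <= M)%R).
  { eapply Rle_trans; [apply Cmod_ge_0|]. apply (H z z Hz Hz). }
  (* The first radius keeps [w] in the disc; the second brings the remainder [M * h ^ 2] below
     [eps * h], with [M + 1] in place of [M] because [M] may be 0. *)
  apply locally_Cmod. exists (Rmin (r - Cmod z) (eps / (M + 1))). split.
  { apply Rmin_pos; [lra|]. apply Rdiv_lt_0_compat; lra. }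
  intros w Hw.
  assert (H1 := Rlt_le_trans _ _ _ Hw (Rmin_l _ _)).
  assert (H2 := Rlt_le_trans _ _ _ Hw (Rmin_r _ _)).
  assert (Hwr : (Cmod w < r)%R).
  { replace w with ((w - z) + z) by ring.
    eapply Rle_lt_trans; [apply Cmod_triangle|lra]. }
  destruct (H z w Hz Hwr) as (_ & _ & _ & H4).
  apply Rle_trans with (1 := H4).
  pose proof (Cmod_ge_0 (w - z)) as Hh. set (h := Cmod (w - z)) in *.
  replace (M * h ^ 2)%R with (M * h * h)%R by ring.
  apply Rmult_le_compat_r; [easy|].
  apply Rle_trans with ((M + 1) * (eps / (M + 1)))%R; [nra|].
  right. field. lra.
Qed.

(** * The paired product *)

(* [(1 + x/(2j-1)) / (1 + x/(2j)) = 1 + pair_dev j x], where the left-hand side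
   is the product of the factors of index [2j-1] and [2j] without their
   exponentials. *)
Definition pair_dev (j : nat) (x : C) : C :=
  x / (RtoC (2 * INR j - 1) * (x + RtoC (2 * INR j))).

(** The complex derivative of [pair_dev j], in closed form. *)
Definition pair_dev' (j : nat) (x : C) : C :=
  RtoC (2 * INR j) /
  (RtoC (2 * INR j - 1) * ((x + RtoC (2 * INR j)) * (x + RtoC (2 * INR j)))).

(** The indices run from [J + 1] to [J + n]: the offset [J] cuts off finitely many pairs, so that
    the remaining ones have no poles on a given disc. *)
Fixpoint pair_prod (J n : nat) (x : C) : C :=
  match n with
  | O => 1
  | S m => pair_prod J m x * (1 + pair_dev (J + S m) x)
  end.

(** The derivative of [pair_prod], by the product rule; it is tied to [pair_prod] through the
    remainder bound of [C11_bounded]. *)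
Fixpoint pair_prod' (J n : nat) (x : C) : C :=
  match n with
  | O => 0
  | S m => pair_prod' J m x * (1 + pair_dev (J + S m) x)
           + pair_prod J m x * pair_dev' (J + S m) x
  end.

Definition pair_lim (J : nat) (x : C) : C :=
  Clim_seq (fun n => pair_prod J n x).

Lemma C11_bounded_ext (r : R) (f f' g g' : C -> C) (M : R) :
  (forall z, f z = g z) -> (forall z, f' z = g' z) ->
  C11_bounded r f f' M -> C11_bounded r g g' M.
Proof.
  intros E E' H z w Hz Hw. rewrite <- !E, <- E'. now apply H.
Qed.

Lemma Cmod_div_le (p q : C) (P Q : R) :
  (0 < Q)%R -> (Cmod p <= P)%R -> (Q <= Cmod q)%R ->
  (Cmod (p / q) <= P / Q)%R.
Proof.
  intros HQ Hp Hq. rewrite Cmod_div by (apply Cmod_gt_0; lra).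
  apply Rmult_le_compat; [apply Cmod_ge_0| |easy|].
  - left. apply Rinv_0_lt_compat. lra.
  - now apply Rinv_le_contravar.
Qed.

(** With [t = INR j], this bounds the denominator of [pair_dev j] away from 0 on the disc of radius
    [j]. *)
Lemma Cmod_shift_ge (z : C) (t : R) :
  (Cmod z <= t)%R -> (t <= Cmod (z + RtoC (2 * t)))%R.
Proof.
  intros H. pose proof (Cmod_ge_0 z) as H0.
  pose proof (Cmod_triangle (z + RtoC (2 * t)) (- z)) as T.
  rewrite Cmod_opp in T.
  replace (z + RtoC (2 * t) + - z) with (RtoC (2 * t)) in T by ring.
  rewrite Cmod_R, Rabs_pos_eq in T by lra. lra.
Qed.

(** With [t = INR j], the numbers [2j - 1], [z + 2j] and [w + 2j] all have modulus at least [t]. The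
    four constants come out as [r / t^2], [2 / t^2], [2 / t^2] and [2 / t^3], and [(r + 2) / t^2]
    dominates them all since [t >= 1]. *)
Lemma pair_dev_C11_bounded (r : R) (j : nat) :
  (1 <= INR j)%R -> (0 <= r <= INR j)%R ->
  C11_bounded r (pair_dev j) (pair_dev' j) ((r + 2) / INR j ^ 2)%R.
Proof.
  intros Hj [Hr Hrj] z w Hz Hw. unfold pair_dev, pair_dev'.
  set (t := INR j) in *.
  set (A := RtoC (2 * t - 1)).
  assert (HA : (t <= Cmod A)%R).
  { unfold A. rewrite Cmod_R, Rabs_pos_eq; lra. }
  assert (HZ := Cmod_shift_ge z t ltac:(lra)).
  assert (HW := Cmod_shift_ge w t ltac:(lra)).
  set (Z := z + RtoC (2 * t)) in *. set (W := w + RtoC (2 * t)) in *.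
  assert (A0 : A <> 0) by (apply Cmod_gt_0; lra).
  assert (Z0 : Z <> 0) by (apply Cmod_gt_0; lra).
  assert (W0 : W <> 0) by (apply Cmod_gt_0; lra).
  assert (mul_le : forall (x y : R) (a b : C), (0 <= x)%R -> (0 <= y)%R ->
     (x <= Cmod a)%R -> (y <= Cmod b)%R -> (x * y <= Cmod (a * b))%R).
  { intros x y a b Hx Hy Ha Hb. rewrite Cmod_mult.
    now apply Rmult_le_compat. }
  assert (Ht2 : (0 < t * t)%R) by nra.
  assert (Ht3 : (0 < t * (t * t))%R) by nra.
  assert (Ht4 : (0 < t * (t * (t * t)))%R) by nra.
  assert (H2t : (Cmod (RtoC (2 * t)) <= 2 * t)%R).
  { rewrite Cmod_R, Rabs_pos_eq; lra. }
  pose proof (Cmod_ge_0 (w - z)) as Hh.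
  assert (Hi : (0 < / t ^ 2)%R).
  { apply Rinv_0_lt_compat. replace (t ^ 2)%R with (t * t)%R by ring. easy. }
  repeat split.
  - apply Rle_trans with (r / (t * t))%R.
    + apply Cmod_div_le; [easy|lra|]. apply mul_le; lra.
    + replace (t * t)%R with (t ^ 2)%R by ring.
      apply Rmult_le_compat_r; lra.
  - apply Rle_trans with (2 * t / (t * (t * t)))%R.
    + apply Cmod_div_le; try easy. apply mul_le; try lra. apply mul_le; lra.
    + replace (2 * t / (t * (t * t)))%R with (2 * / t ^ 2)%R by (field; lra).
      apply Rmult_le_compat_r; lra.
  - replace (w / (A * W) - z / (A * Z)) with
      (RtoC (2 * t) * (w - z) / (A * (W * Z))).
    2:{ replace (w - z) with (W - Z) by (unfold W, Z; ring).
        replace w with (W - RtoC (2 * t)) by (unfold W; ring).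
        replace z with (Z - RtoC (2 * t)) by (unfold Z; ring).
        field. auto. }
    apply Rle_trans with (2 * t * Cmod (w - z) / (t * (t * t)))%R.
    + apply Cmod_div_le; [easy| |].
      * rewrite Cmod_mult. now apply Rmult_le_compat_r.
      * apply mul_le; try lra. apply mul_le; lra.
    + replace (2 * t * Cmod (w - z) / (t * (t * t)))%R with
        (2 * / t ^ 2 * Cmod (w - z))%R by (field; lra).
      apply Rmult_le_compat_r; [easy|]. apply Rmult_le_compat_r; lra.
  - replace (w / (A * W) - z / (A * Z) - (w - z) * (RtoC (2 * t) / (A * (Z * Z))))
      with (- (RtoC (2 * t) * ((w - z) * (w - z))) / (A * (W * (Z * Z)))).
    2:{ replace (w - z) with (W - Z) by (unfold W, Z; ring).
        replace w with (W - RtoC (2 * t)) by (unfold W; ring).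
        replace z with (Z - RtoC (2 * t)) by (unfold Z; ring).
        field. auto. }
    apply Rle_trans with
      (2 * t * (Cmod (w - z) * Cmod (w - z)) / (t * (t * (t * t))))%R.
    + apply Cmod_div_le; [easy| |].
      * rewrite Cmod_opp, !Cmod_mult. apply Rmult_le_compat_r; [|easy].
        now apply Rmult_le_pos.
      * apply mul_le; try lra. apply mul_le; try lra. apply mul_le; lra.
    + replace (2 * t * (Cmod (w - z) * Cmod (w - z)) / (t * (t * (t * t))))%R
        with (2 / t * (/ t ^ 2) * Cmod (w - z) ^ 2)%R by (field; lra).
      apply Rmult_le_compat_r; [apply pow2_ge_0|].
      apply Rmult_le_compat_r; [lra|].
      apply Rle_trans with (2 / 1)%R; [|lra].
      apply Rmult_le_compat_l; [lra|]. apply Rinv_le_contravar; lra.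
Qed.

(** Converts the [1 / j^2] size of the deviations into the decrements that [Ccv_telescope]
    expects. *)
Lemma inv_sqr_le_telescope (m : R) :
  (0 < m)%R -> (/ (m + 1) ^ 2 <= / m - / (m + 1))%R.
Proof.
  intros Hm. replace (/ m - / (m + 1))%R with (/ (m * (m + 1)))%R
    by (field; lra).
  apply Rinv_le_contravar; nra.
Qed.

Lemma INR_plus_S (J n : nat) : INR (J + S n) = (INR (J + n) + 1)%R.
Proof. now rewrite Nat.add_succ_r, S_INR. Qed.

(** * Convergence, differentiability and non-vanishing of the tail product on a disc *)

Section Tail.

Variables (r : R) (J : nat).
Hypothesis r_ge0 : (0 <= r)%R.
(** The deviations of index above [J] then sum to at most [(r + 2) / J <= 1/2] on the disc of radius
    [r], which keeps the tail away from 0. *)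
Hypothesis J_large : (2 * (r + 2) <= INR J)%R.

Let c := (r + 2)%R.
Let t (n : nat) := (/ INR (J + n))%R.

Let pos (n : nat) : (4 <= INR (J + n))%R.
Proof. rewrite plus_INR. pose proof (pos_INR n). lra. Qed.

Let t_pos (n : nat) : (0 < t n)%R.
Proof. apply Rinv_0_lt_compat. pose proof (pos n). lra. Qed.

Let pair_dev_tail_bounded (n : nat) :
  C11_bounded r (pair_dev (J + S n)) (pair_dev' (J + S n))
    (c * (t n - t (S n)))%R.
Proof.
  pose proof (pos n) as H. pose proof (pos (S n)) as H'.
  apply C11_bounded_le with ((r + 2) / INR (J + S n) ^ 2)%R.
  - unfold c, t. apply Rmult_le_compat_l; [lra|]. rewrite INR_plus_S.
    apply inv_sqr_le_telescope. lra.
  - apply pair_dev_C11_bounded; [lra|].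
    rewrite plus_INR. pose proof (pos_INR (S n)). lra.
Qed.

Let M := exp (3 * c * t O).

Let M_bound (n : nat) : (exp (3 * c * (t O - t n)) <= M)%R.
Proof.
  unfold M. left. apply exp_increasing. pose proof (t_pos n). unfold c. nra.
Qed.

(** Expanding [P * (1 + d)] as [P + P * d] charges the factor 3 of [C11_bounded_mult] to the small
    term only; otherwise it would accumulate to [3^n]. Then [1 + s <= exp s] makes the exponents
    telescope. *)
Lemma pair_prod_C11_bounded (n : nat) :
  C11_bounded r (pair_prod J n) (pair_prod' J n) (exp (3 * c * (t O - t n))).
Proof.
  induction n.
  - simpl. replace (3 * c * (t O - t O))%R with 0%R by ring.
    rewrite exp_0. pose proof (C11_bounded_const r 1) as H.
    rewrite Cmod_1 in H. exact H.
  - set (E := exp (3 * c * (t O - t n))) in *.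
    apply C11_bounded_le with (E + 3 * E * (c * (t n - t (S n))))%R.
    + replace (3 * c * (t O - t (S n)))%R with
        (3 * c * (t O - t n) + 3 * c * (t n - t (S n)))%R by ring.
      rewrite exp_plus. fold E.
      replace (E + 3 * E * (c * (t n - t (S n))))%R with
        (E * (1 + 3 * c * (t n - t (S n))))%R by ring.
      apply Rmult_le_compat_l; [left; apply exp_pos|]. apply exp_ineq1_le.
    + eapply C11_bounded_ext;
        [| |apply (C11_bounded_plus _ _ _ _ _ _ _ IHn
                     (C11_bounded_mult _ _ _ _ _ _ _ IHn
                        (pair_dev_tail_bounded n)))];
        intros z; simpl; ring.
Qed.

(** Weierstrass's inequality: a product of factors [1 - e_i] is at least 1 minus the sum of the
    [e_i], here at least [1/2] by the choice of [J]. *)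
Lemma pair_prod_Cmod_ge (n : nat) (z : C) :
  (Cmod z < r)%R -> (/ 2 <= Cmod (pair_prod J n z))%R.
Proof.
  intros Hz.
  assert (Hc : (c * t O <= / 2)%R).
  { unfold t, c. rewrite Nat.add_0_r.
    apply Rmult_le_reg_r with (INR J); [lra|].
    rewrite Rmult_assoc, Rinv_l by lra. lra. }
  apply Rle_trans with (1 - c * (t O - t n))%R.
  { pose proof (t_pos n) as H. unfold c in *. nra. }
  induction n.
  - simpl. rewrite Cmod_1. lra.
  - simpl. rewrite Cmod_mult.
    destruct (pair_dev_tail_bounded n z z Hz Hz) as (Hd & _).
    pose proof (Cmod_ge_0 (pair_dev (J + S n) z)) as Hd0.
    pose proof (Cmod_triangle (1 + pair_dev (J + S n) z)
                  (- pair_dev (J + S n) z)) as T.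
    rewrite Cmod_opp in T.
    replace (1 + pair_dev (J + S n) z + - pair_dev (J + S n) z) with (RtoC 1)
      in T by ring.
    rewrite Cmod_1 in T.
    set (e := (c * (t n - t (S n)))%R) in *.
    replace (c * (t O - t (S n)))%R with (c * (t O - t n) + e)%R
      by (unfold e; ring).
    assert (Hs : (0 <= c * (t O - t n))%R).
    { apply Rmult_le_pos; [unfold c; lra|].
      assert (t n <= t O)%R; [|lra].
      apply Rinv_le_contravar; [pose proof (pos O); lra|].
      apply le_INR. lia. }
    assert (Hc' : (0 <= c)%R) by (unfold c; lra).
    pose proof (Rmult_le_pos _ _ Hc' (Rlt_le _ _ (t_pos n))).
    pose proof (Rmult_le_pos _ _ Hc' (Rlt_le _ _ (t_pos (S n)))).
    set (s := (c * (t O - t n))%R) in *.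
    assert (e <= 1)%R by (unfold e, s in *; nra).
    assert (s <= 1)%R by (unfold s; nra).
    apply Rle_trans with ((1 - s) * (1 - e))%R; [nra|].
    apply Rmult_le_compat; lra.
Qed.

(** Consecutive terms differ by [P * d], respectively [P' * d + P * d']. Since [P] and [P'] are
    bounded by [M], these are at most [M], respectively [2 * M], times a telescoping decrement. *)
Lemma pair_prod_tail_cv (z : C) :
  (Cmod z < r)%R ->
  Ccv (fun n => pair_prod J n z) (pair_lim J z) /\
  Ccv (fun n => pair_prod' J n z) (Clim_seq (fun n => pair_prod' J n z)).
Proof.
  intros Hz.
  assert (HM : (0 < M)%R) by apply exp_pos.
  assert (Hc : (0 < c)%R) by (unfold c; lra).
  split.
  - apply Ccv_telescope with (fun n => M * c * t n)%R.
    { intros n. pose proof (t_pos n). apply Rmult_le_pos; nra. }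
    intros n. simpl.
    replace (pair_prod J n z * (1 + pair_dev (J + S n) z) - pair_prod J n z)
      with (pair_prod J n z * pair_dev (J + S n) z) by ring.
    rewrite Cmod_mult.
    destruct (pair_dev_tail_bounded n z z Hz Hz) as (Hd & _).
    destruct (pair_prod_C11_bounded n z z Hz Hz) as (Hp & _).
    pose proof (M_bound n).
    replace (M * c * t n - M * c * t (S n))%R with (M * (c * (t n - t (S n))))%R
      by ring.
    apply Rmult_le_compat; try apply Cmod_ge_0; lra.
  - apply Ccv_telescope with (fun n => 2 * M * c * t n)%R.
    { intros n. pose proof (t_pos n). repeat apply Rmult_le_pos; lra. }
    intros n. simpl.
    replace (pair_prod' J n z * (1 + pair_dev (J + S n) z) +
        pair_prod J n z * pair_dev' (J + S n) z - pair_prod' J n z)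
      with (pair_prod' J n z * pair_dev (J + S n) z
            + pair_prod J n z * pair_dev' (J + S n) z) by ring.
    eapply Rle_trans; [apply Cmod_triangle|].
    rewrite !Cmod_mult.
    destruct (pair_dev_tail_bounded n z z Hz Hz) as (Hd & Hd' & _).
    destruct (pair_prod_C11_bounded n z z Hz Hz) as (Hp & Hp' & _).
    pose proof (M_bound n).
    replace (2 * M * c * t n - 2 * M * c * t (S n))%R with
      (M * (c * (t n - t (S n))) + M * (c * (t n - t (S n))))%R by ring.
    apply Rplus_le_compat; apply Rmult_le_compat; try apply Cmod_ge_0; lra.
Qed.

Lemma pair_lim_differentiable (z : C) :
  (Cmod z < r)%R -> C_differentiable (pair_lim J) z.
Proof.
  apply C11_bounded_differentiable with
    (fun z => Clim_seq (fun n => pair_prod' J n z)) M.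
  apply C11_bounded_lim with (pair_prod J) (pair_prod' J).
  - intros n. apply C11_bounded_le with (1 := M_bound n).
    apply pair_prod_C11_bounded.
  - intros w Hw. exact (proj1 (pair_prod_tail_cv w Hw)).
  - intros w Hw. exact (proj2 (pair_prod_tail_cv w Hw)).
Qed.

Lemma pair_lim_neq_0 (z : C) : (Cmod z < r)%R -> pair_lim J z <> 0.
Proof.
  intros Hz. destruct (pair_prod_tail_cv z Hz) as [H _].
  apply Ccv_Cmod in H.
  assert (/ 2 <= Cmod (pair_lim J z))%R; [|apply Cmod_gt_0; lra].
  apply (is_lim_seq_le (fun _ => / 2)%R _ (Finite _) (Finite _)
           (fun n => pair_prod_Cmod_ge n z Hz) (is_lim_seq_const _) H).
Qed.

End Tail.

Lemma pair_prod_split (J n : nat) (x : C) :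
  pair_prod 0 (J + n) x = pair_prod 0 J x * pair_prod J n x.
Proof.
  induction n.
  - rewrite Nat.add_0_r. simpl. ring.
  - rewrite Nat.add_succ_r. simpl. rewrite IHn.
    rewrite Nat.add_succ_r. ring.
Qed.

Lemma Ccv_incr_n (u : nat -> C) (l : C) (N : nat) :
  Ccv (fun n => u (N + n)%nat) l -> Ccv u l.
Proof.
  intros [H1 H2]. split; apply (is_lim_seq_incr_n _ N);
    (eapply is_lim_seq_ext; [|eassumption]); intros n; simpl;
    now rewrite Nat.add_comm.
Qed.

Lemma pair_prod_cv (r : R) (J : nat) (z : C) :
  (0 <= r)%R -> (2 * (r + 2) <= INR J)%R -> (Cmod z < r)%R ->
  Ccv (fun n => pair_prod 0 n z) (pair_prod 0 J z * pair_lim J z).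
Proof.
  intros Hr HJ Hz. apply (Ccv_incr_n _ _ J).
  apply Ccv_ext with (fun n => pair_prod 0 J z * pair_prod J n z).
  { intros n. symmetry. apply pair_prod_split. }
  apply Ccv_mult; [apply Ccv_const|]. exact (proj1 (pair_prod_tail_cv r J Hr HJ z Hz)).
Qed.

(** * The alternating harmonic series and the original product *)

Fixpoint harmonic (n : nat) : R :=
  match n with
  | O => 0
  | S m => (harmonic m + / INR (S m))%R
  end.

Fixpoint alt_harmonic (n : nat) : R :=
  match n with
  | O => 0
  | S m => (alt_harmonic m +
             (if Nat.odd (S m) then / INR (S m) else - / INR (S m)))%R
  end.

Lemma odd_double_S (n : nat) : Nat.odd (S (2 * n)) = true.
Proof. apply Nat.odd_spec. exists n. lia. Qed.

Lemma odd_double_SS (n : nat) : Nat.odd (S (S (2 * n))) = false.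
Proof.
  rewrite <- Nat.negb_even. apply Bool.negb_false_iff, Nat.even_spec.
  exists (S n). lia.
Qed.

Lemma double_S (n : nat) : (2 * S n = S (S (2 * n)))%nat.
Proof. lia. Qed.

(** Catalan's identity [1 - 1/2 + ... - 1/(2n) = 1/(n+1) + ... + 1/(2n)]; the right-hand side can be
    compared with logarithms. *)
Lemma alt_harmonic_double (n : nat) :
  alt_harmonic (2 * n) = (harmonic (n + n) - harmonic n)%R.
Proof.
  induction n; [simpl; ring|].
  rewrite double_S.
  replace (S n + S n)%nat with (S (S (n + n))) by lia.
  cbn [alt_harmonic harmonic].
  rewrite odd_double_S, odd_double_SS, IHn.
  replace (n + n)%nat with (2 * n)%nat by lia.
  rewrite !S_INR, mult_INR. simpl (INR 2). pose proof (pos_INR n).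
  field. lra.
Qed.

Lemma ln_le_minus_1 (y : R) : (0 < y)%R -> (ln y <= y - 1)%R.
Proof.
  intros Hy. pose proof (exp_ineq1_le (ln y)) as H. rewrite exp_ln in H; lra.
Qed.

Lemma ln_S_minus_le (k : R) : (0 < k)%R -> (ln (k + 1) - ln k <= / k)%R.
Proof.
  intros Hk. rewrite <- ln_div by lra.
  eapply Rle_trans; [apply ln_le_minus_1, Rdiv_lt_0_compat; lra|].
  right. field. lra.
Qed.

Lemma inv_S_le_ln (k : R) : (0 < k)%R -> (/ (k + 1) <= ln (k + 1) - ln k)%R.
Proof.
  intros Hk.
  assert (H : (ln (k / (k + 1)) <= k / (k + 1) - 1)%R).
  { apply ln_le_minus_1, Rdiv_lt_0_compat; lra. }
  rewrite ln_div in H by lra.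
  replace (k / (k + 1) - 1)%R with (- / (k + 1))%R in H by (field; lra). lra.
Qed.

(** The inequalities [1/(k+1) <= ln (k+1) - ln k <= 1/k], summed over a block of indices. For
    [m = n] both bounds tend to [ln 2]. *)
Lemma harmonic_bounds (n m : nat) :
  (1 <= n)%nat ->
  (ln (INR (n + m) + 1) - ln (INR n + 1) <= harmonic (n + m) - harmonic n
   <= ln (INR (n + m)) - ln (INR n))%R.
Proof.
  intros Hn.
  assert (H1 : (1 <= INR n)%R) by (now apply (le_INR 1)).
  induction m; [rewrite Nat.add_0_r; lra|].
  rewrite Nat.add_succ_r. cbn [harmonic]. rewrite S_INR.
  assert (H2 : (1 <= INR (n + m))%R) by (apply (le_INR 1); lia).
  pose proof (ln_S_minus_le (INR (n + m) + 1)).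
  pose proof (inv_S_le_ln (INR (n + m))). lra.
Qed.

Lemma is_lim_seq_inv_INR_S : is_lim_seq (fun n => / (INR n + 1))%R 0%R.
Proof.
  apply is_lim_seq_ext with (fun n => / INR (S n))%R.
  { intros n. now rewrite S_INR. }
  apply (is_lim_seq_incr_1 (fun n => / INR n)%R).
  apply (is_lim_seq_inv _ p_infty); [apply is_lim_seq_INR|easy].
Qed.

Lemma is_lim_seq_alt_harmonic_double :
  is_lim_seq (fun n => alt_harmonic (2 * n)) (ln 2).
Proof.
  apply is_lim_seq_le_le_loc with
    (fun n => ln (2 - / (INR n + 1)))%R (fun _ => ln 2).
  - exists 1%nat. intros n Hn.
    assert (H1 : (1 <= INR n)%R) by (now apply (le_INR 1)).
    rewrite alt_harmonic_double.
    destruct (harmonic_bounds n n Hn) as [L U].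
    rewrite plus_INR in L, U. rewrite <- ln_div in L, U by lra.
    replace ((INR n + INR n + 1) / (INR n + 1))%R with
      (2 - / (INR n + 1))%R in L by (field; lra).
    replace ((INR n + INR n) / INR n)%R with 2%R in U by (field; lra).
    lra.
  - apply is_lim_seq_continuous with (f := ln).
    + apply derivable_continuous_pt. exists (/ 2)%R.
      apply derivable_pt_lim_ln. lra.
    + replace 2%R with (2 - 0)%R at 1 by ring.
      apply is_lim_seq_minus'; [apply is_lim_seq_const|].
      apply is_lim_seq_inv_INR_S.
  - apply is_lim_seq_const.
Qed.

Lemma is_lim_seq_inv_odd : is_lim_seq (fun n => / INR (2 * n + 1))%R 0%R.
Proof.
  apply is_lim_seq_le_le with (fun _ => 0%R) (fun n => / (INR n + 1))%R.
  - intros n. rewrite plus_INR, mult_INR. simpl. pose proof (pos_INR n). split.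
    + left. apply Rinv_0_lt_compat. lra.
    + apply Rinv_le_contravar; lra.
  - apply is_lim_seq_const.
  - apply is_lim_seq_inv_INR_S.
Qed.

Lemma is_lim_seq_alt_harmonic_odd :
  is_lim_seq (fun n => alt_harmonic (2 * n + 1)) (ln 2).
Proof.
  apply is_lim_seq_ext with
    (fun n => alt_harmonic (2 * n) + / INR (2 * n + 1))%R.
  { intros n. rewrite Nat.add_1_r. cbn [alt_harmonic].
    now rewrite odd_double_S. }
  rewrite <- (Rplus_0_r (ln 2)).
  apply is_lim_seq_plus'; [apply is_lim_seq_alt_harmonic_double|].
  apply is_lim_seq_inv_odd.
Qed.

(** * From the original product to the paired one *)

Definition even_factors_defined (x : C) : Prop :=
  forall k : nat, (1 <= k)%nat -> Nat.Even k -> x <> - RtoC (INR k).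

Lemma shift_neq_0 (x b : C) : x <> - b -> x + b <> 0.
Proof. intros H E. now apply H, Cplus_eq_0_opp. Qed.

Lemma RtoC_neq_0 (r : R) : r <> 0%R -> RtoC r <> 0.
Proof. intros H E. now apply H, RtoC_inj. Qed.

Lemma even_factors_defined_neq_0 (x : C) (j : nat) :
  even_factors_defined x -> (1 <= j)%nat -> x + RtoC (2 * INR j) <> 0.
Proof.
  intros Hx Hj. apply shift_neq_0. rewrite <- (mult_INR 2).
  apply Hx; [lia|]. now exists j.
Qed.

Lemma one_plus_pair_dev (j : nat) (x : C) :
  (1 <= j)%nat -> x + RtoC (2 * INR j) <> 0 ->
  1 + pair_dev j x =
  RtoC (2 * INR j) / RtoC (2 * INR j - 1) * (x + RtoC (2 * INR j - 1))
  / (x + RtoC (2 * INR j)).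
Proof.
  intros Hj Hx. unfold pair_dev.
  assert (H1 : (1 <= INR j)%R) by (now apply (le_INR 1)).
  assert (H2 : RtoC (2 * INR j - 1) <> 0) by (apply RtoC_neq_0; lra).
  rewrite RtoC_minus in *. field. auto.
Qed.

Lemma Cprod_Gamma_factor_double (x : C) (N : nat) :
  even_factors_defined x ->
  Cprod (Gamma_factor x) (2 * N) =
  Cexp (- (x * RtoC (alt_harmonic (2 * N)))) * pair_prod 0 N x.
Proof.
  intros Hx. induction N.
  - simpl. replace (- (x * 0)) with (RtoC 0) by ring. rewrite Cexp_0. ring.
  - rewrite double_S. cbn [Cprod alt_harmonic pair_prod].
    rewrite IHN. unfold Gamma_factor.
    rewrite odd_double_S, odd_double_SS. rewrite Nat.add_0_l.
    assert (Hj := even_factors_defined_neq_0 x (S N) Hx ltac:(lia)).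
    rewrite one_plus_pair_dev by (easy || lia).
    replace (INR (S (2 * N))) with (2 * INR (S N) - 1)%R
      by (rewrite !S_INR, mult_INR; simpl; ring).
    replace (INR (S (S (2 * N)))) with (2 * INR (S N))%R
      by (rewrite !S_INR, mult_INR; simpl; ring).
    set (t := INR (S N)) in *.
    assert (Ht : (1 <= t)%R) by (apply (le_INR 1); lia).
    assert (H1 : RtoC (2 * t - 1) <> 0) by (apply RtoC_neq_0; lra).
    assert (H2 : RtoC (2 * t) <> 0) by (apply RtoC_neq_0; lra).
    set (A := alt_harmonic (2 * N)).
    (* The odd factor contributes the exponent [-x/(2t-1)]; the even factor is inverted and
       contributes [+x/(2t)]. *)
    replace (- (x * RtoC (A + / (2 * t - 1) + - / (2 * t)))) with
      (- (x * RtoC A) + - (x / RtoC (2 * t - 1)) + x / RtoC (2 * t)).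
    2:{ rewrite !RtoC_plus, RtoC_opp, !RtoC_inv by lra.
        unfold Cdiv. ring. }
    rewrite !Cexp_plus.
    rewrite (Cexp_opp (x / RtoC (2 * t))).
    pose proof (Cexp_neq_0 (x / RtoC (2 * t))) as H3.
    set (E := Cexp (x / RtoC (2 * t))) in *.
    set (F := Cexp (- (x / RtoC (2 * t - 1)))).
    set (G := Cexp (- (x * RtoC A))).
    set (a := RtoC (2 * t)) in *. set (b := RtoC (2 * t - 1)) in *.
    replace (1 + x / a) with ((x + a) / a) by (field; auto).
    field. auto.
Qed.

Lemma Ccv_Cprod_Gamma_factor (x l : C) :
  even_factors_defined x -> Ccv (fun n => pair_prod 0 n x) l ->
  Ccv (Cprod (Gamma_factor x)) (Cexp (- (x * RtoC (ln 2))) * l).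
Proof.
  intros Hx Hl.
  assert (exp_cv : forall u, is_lim_seq u (ln 2) ->
    Ccv (fun n => Cexp (- (x * RtoC (u n)))) (Cexp (- (x * RtoC (ln 2))))).
  { intros u Hu. apply Ccv_Cexp.
    apply Ccv_ext with (fun n => - x * RtoC (u n)); [intros; ring|].
    replace (- (x * RtoC (ln 2))) with (- x * RtoC (ln 2)) by ring.
    apply Ccv_mult; [apply Ccv_const|]. now apply Ccv_RtoC. }
  assert (H0 := Ccv_mult _ _ _ _ (exp_cv _ is_lim_seq_alt_harmonic_double) Hl).
  apply Ccv_even_odd.
  - eapply Ccv_ext; [|exact H0].
    intros n. symmetry. now apply Cprod_Gamma_factor_double.
  (* An odd number of factors leaves one unpaired: its exponential enters [alt_harmonic], and the
     rest, [1 + x/(2n+1)], tends to 1. The double sign fits [Ccv_minus]. *)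
  - apply Ccv_ext with (fun n => Cexp (- (x * RtoC (alt_harmonic (2 * n + 1))))
      * pair_prod 0 n x * (1 - - x * RtoC (/ INR (2 * n + 1)))).
    + intros n. rewrite Nat.add_1_r. cbn [Cprod alt_harmonic].
      rewrite Cprod_Gamma_factor_double by easy.
      unfold Gamma_factor. rewrite odd_double_S.
      rewrite RtoC_plus, Cmult_plus_distr_l, Copp_plus_distr, Cexp_plus.
      rewrite RtoC_inv by (apply not_0_INR; lia).
      unfold Cdiv. ring.
    + rewrite <- (Cmult_1_r (_ * l)).
      apply Ccv_mult.
      * apply Ccv_mult; [|easy]. apply (exp_cv (fun n => alt_harmonic (2 * n + 1))).
        apply is_lim_seq_alt_harmonic_odd.
      * pose proof (Ccv_minus _ _ _ _ (Ccv_const 1)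
          (Ccv_mult _ _ _ _ (Ccv_const (- x))
             (Ccv_RtoC _ _ is_lim_seq_inv_odd))) as H.
        replace (1 - - x * 0) with (RtoC 1) in H by ring. exact H.
Qed.

(** The exponentials of the product tend to [Cexp (- (x * ln 2))], which the prefactor
    [Cexp (x * ln 2)] cancels. *)
Lemma GammaTilde_lim (x l : C) :
  even_factors_defined x -> Ccv (fun n => pair_prod 0 n x) l ->
  GammaTilde x = / x * l.
Proof.
  intros Hx Hl. unfold GammaTilde.
  rewrite (Ccv_Clim_seq _ _ (Ccv_Cprod_Gamma_factor x l Hx Hl)).
  rewrite Cexp_opp. pose proof (Cexp_neq_0 (x * RtoC (ln 2))).
  unfold Cdiv. rewrite Cmult_1_l, <- Cmult_assoc. f_equal. now field.
Qed.

Lemma exists_tail_index (r : R) : exists J : nat, (2 * (r + 2) <= INR J)%R.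
Proof.
  destruct (INR_unbounded (2 * (r + 2))) as [J HJ]. exists J. lra.
Qed.

Lemma Cprod_Gamma_factor_converges (x : C) :
  even_factors_defined x -> Cprod_converges (Gamma_factor x).
Proof.
  intros Hx.
  destruct (exists_tail_index (Cmod x + 1)) as [J HJ].
  pose proof (Cmod_ge_0 x).
  eexists. apply Ccv_filterlim. apply Ccv_Cprod_Gamma_factor; [easy|].
  apply (pair_prod_cv (Cmod x + 1) J); lra.
Qed.

(** Index 0 is allowed: it is the origin, the pole coming from [1 / x], treated uniformly with the
    others. *)
Definition even_pole (j : nat) : C := - RtoC (2 * INR j).

Lemma pair_prod_neq_0 (n : nat) (x : C) :
  (forall j, (1 <= j <= n)%nat ->
     x <> - RtoC (2 * INR j - 1) /\ x <> even_pole j) ->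
  pair_prod 0 n x <> 0.
Proof.
  induction n; intros H.
  - exact C1_nz.
  - cbn [pair_prod]. rewrite Nat.add_0_l.
    destruct (H (S n)) as [H1 H2]; [lia|].
    apply Cmult_neq_0; [apply IHn; intros; apply H; lia|].
    rewrite one_plus_pair_dev by (lia || now apply shift_neq_0).
    assert (Ht : (1 <= INR (S n))%R) by (apply (le_INR 1); lia).
    unfold Cdiv. repeat apply Cmult_neq_0; try apply Cinv_neq_0;
      try (apply RtoC_neq_0; lra); now apply shift_neq_0.
Qed.

Lemma even_pole_inj (i j : nat) : even_pole i = even_pole j -> i = j.
Proof.
  unfold even_pole. rewrite <- !RtoC_opp. intros E. apply RtoC_inj in E.
  apply INR_eq. lra.
Qed.

Lemma even_pole_neq_odd (i j : nat) :
  (1 <= j)%nat -> even_pole i <> - RtoC (2 * INR j - 1).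
Proof.
  intros Hj. unfold even_pole. rewrite <- !RtoC_opp. intros E. apply RtoC_inj in E.
  assert (E' : INR (2 * i + 1) = INR (2 * j)).
  { rewrite plus_INR, !mult_INR. simpl. lra. }
  apply INR_eq in E'. lia.
Qed.

(** * Poles of GammaTilde *)

(** The rational part of [GammaTilde], which carries the poles [even_pole 0] to [even_pole n]. *)
Definition pair_prod_over (n : nat) (z : C) : C := / z * pair_prod 0 n z.

(** The numerator of [1 + pair_dev j z] over the denominator [z + 2j], expanded to match
    [holomorphic_at_affine]. *)
Definition pair_num (j : nat) (z : C) : C :=
  RtoC (2 * INR j) / RtoC (2 * INR j - 1) * RtoC (2 * INR j - 1)
  + RtoC (2 * INR j) / RtoC (2 * INR j - 1) * z.

Lemma pair_num_neq_0 (j : nat) (z : C) :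
  (1 <= j)%nat -> z <> - RtoC (2 * INR j - 1) -> pair_num j z <> 0.
Proof.
  intros Hj Hz.
  assert (Ht : (1 <= INR j)%R) by (now apply (le_INR 1)).
  assert (Ha : RtoC (2 * INR j) <> 0) by (apply RtoC_neq_0; lra).
  assert (Hb : RtoC (2 * INR j - 1) <> 0) by (apply RtoC_neq_0; lra).
  unfold pair_num. rewrite <- Cmult_plus_distr_l.
  apply Cmult_neq_0.
  - apply Cmult_neq_0; [easy|now apply Cinv_neq_0].
  - rewrite Cplus_comm. now apply shift_neq_0.
Qed.

Lemma pair_prod_over_S (n : nat) (z : C) :
  z <> even_pole (S n) ->
  pair_prod_over (S n) z =
  pair_prod_over n z * pair_num (S n) z * / (z + RtoC (2 * INR (S n))).
Proof.
  intros Hz. unfold pair_prod_over, pair_num.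
  cbn [pair_prod]. rewrite Nat.add_0_l.
  rewrite one_plus_pair_dev by (lia || now apply shift_neq_0).
  unfold Cdiv. ring.
Qed.

Lemma pair_prod_over_0 (z : C) :
  / (z + RtoC (2 * INR 0)) = pair_prod_over 0 z.
Proof.
  unfold pair_prod_over. cbn [pair_prod]. rewrite Cmult_1_r. f_equal.
  simpl. rewrite Rmult_0_r. ring.
Qed.

Lemma pair_prod_over_holomorphic (n : nat) (a : C) :
  (forall j, (j <= n)%nat -> a <> even_pole j) ->
  holomorphic_at (pair_prod_over n) a.
Proof.
  induction n; intros Ha.
  - apply holomorphic_at_ext with (fun z => / (z + RtoC (2 * INR 0))).
    + apply filter_forall, pair_prod_over_0.
    + now apply holomorphic_at_inv_shift, (Ha O).
  - apply holomorphic_at_ext with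
      (fun z => pair_prod_over n z * pair_num (S n) z
                * / (z + RtoC (2 * INR (S n)))).
    + generalize (locally_neq _ _ (Ha (S n) (le_n _))). apply filter_imp.
      intros z Hz. symmetry. now apply pair_prod_over_S.
    + apply (holomorphic_at_mult
               (fun z => pair_prod_over n z * pair_num (S n) z)).
      * apply holomorphic_at_mult; [apply IHn; auto|].
        apply holomorphic_at_affine.
      * now apply holomorphic_at_inv_shift, (Ha (S n)).
Qed.

(** Each new factor adds one pole, at a point where the earlier product is holomorphic and nonzero.
    At the earlier poles the new factor is itself holomorphic and nonzero, so they persist. *)
Lemma pair_prod_over_pole (n m : nat) :
  (m <= n)%nat -> has_pole (pair_prod_over n) (even_pole m).
Proof.
  induction n; intros Hm.
  - assert (m = O) as -> by lia.
    apply has_pole_ext with (fun z => / (z + RtoC (2 * INR 0))).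
    + apply locally'_of_locally, filter_forall, pair_prod_over_0.
    + apply has_pole_inv_shift.
  - set (b := RtoC (2 * INR (S n))).
    destruct (Nat.eq_dec m (S n)) as [->|Hne].
    + apply has_pole_ext with
        (fun z => / (z + b) * (pair_prod_over n z * pair_num (S n) z)).
      * unfold locally', within. apply filter_forall. intros z Hz.
        rewrite pair_prod_over_S by easy. fold b. ring.
      * apply (has_pole_mult (fun z => / (z + b))).
        -- apply has_pole_inv_shift.
        -- apply holomorphic_at_mult; [|apply holomorphic_at_affine].
           apply pair_prod_over_holomorphic. intros j Hj E.
           apply even_pole_inj in E. lia.
        -- apply Cmult_neq_0.
           ++ apply Cmult_neq_0.
              ** apply Cinv_neq_0.
                 unfold even_pole. rewrite <- RtoC_opp. apply RtoC_neq_0.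
                 pose proof (lt_0_INR (S n) ltac:(lia)). lra.
              ** apply pair_prod_neq_0. intros j Hj. split.
                 --- apply even_pole_neq_odd. lia.
                 --- intros E. apply even_pole_inj in E. lia.
           ++ apply pair_num_neq_0; [lia|]. apply even_pole_neq_odd. lia.
    + assert (Hneq : even_pole m <> even_pole (S n)).
      { intros E. now apply even_pole_inj in E. }
      apply has_pole_ext with
        (fun z => pair_prod_over n z * (pair_num (S n) z * / (z + b))).
      * apply locally'_of_locally. generalize (locally_neq _ _ Hneq).
        apply filter_imp. intros z Hz. rewrite pair_prod_over_S by easy.
        fold b. ring.
      * apply (has_pole_mult (pair_prod_over n)).
        -- apply IHn. lia.
        -- apply holomorphic_at_mult; [apply holomorphic_at_affine|].
           now apply holomorphic_at_inv_shift.
        -- apply Cmult_neq_0.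
           ++ apply pair_num_neq_0; [lia|]. apply even_pole_neq_odd. lia.
           ++ now apply Cinv_neq_0, shift_neq_0.
Qed.

Lemma GammaTilde_tail (r : R) (J : nat) (z : C) :
  (0 <= r)%R -> (2 * (r + 2) <= INR J)%R -> (Cmod z < r)%R ->
  (forall j, (j <= J)%nat -> z <> even_pole j) ->
  GammaTilde z = pair_prod_over J z * pair_lim J z.
Proof.
  intros Hr HJ Hz Hp.
  rewrite (GammaTilde_lim z _ ) with
    (2 := pair_prod_cv r J z Hr HJ Hz).
  - unfold pair_prod_over. ring.
  - intros k Hk [j ->]. rewrite mult_INR. simpl (INR 2). fold (even_pole j).
    destruct (le_lt_dec j J) as [Hj|Hj]; [now apply Hp|].
    (* An even pole of index above [J] has modulus [2j > r], so it lies outside the disc. *)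
    intros ->. unfold even_pole in Hz.
    rewrite Cmod_opp, Cmod_R, Rabs_pos_eq in Hz
      by (pose proof (pos_INR j); lra).
    apply lt_INR in Hj. lra.
Qed.

Lemma avoid_even_poles_locally' (a : C) (J : nat) :
  locally' a (fun z => forall j, (j <= J)%nat -> z <> even_pole j).
Proof.
  assert (one : forall j, locally' a (fun z => z <> even_pole j)).
  { intros j. destruct (Ceq_dec a (even_pole j)) as [E|E].
    - rewrite <- E. unfold locally', within. now apply filter_forall.
    - now apply locally'_of_locally, locally_neq. }
  induction J.
  - generalize (one O). apply filter_imp. intros z Hz j Hj.
    now replace j with O by lia.
  - generalize (filter_and _ _ IHJ (one (S J))). apply filter_imp.
    intros z [H1 H2] j Hj.
    destruct (Nat.eq_dec j (S J)) as [->|]; [easy|]. apply H1. lia.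
Qed.

Lemma Cmod_lt_locally (a : C) (r : R) :
  (Cmod a < r)%R -> locally a (fun z => (Cmod z < r)%R).
Proof.
  intros H. apply locally_Cmod. exists (r - Cmod a)%R. split; [lra|].
  intros z Hz. replace z with ((z - a) + a) by ring.
  eapply Rle_lt_trans; [apply Cmod_triangle|lra].
Qed.

(** Locally [GammaTilde] is a rational function times a nonvanishing holomorphic [g]. Equality at
    [a] itself is claimed only off the poles, and the last clause says that [J] is large enough for
    a pole at [a] to belong to the rational part. *)
Lemma GammaTilde_local_form (a : C) :
  exists (J : nat) (g : C -> C),
    locally' a (fun z => GammaTilde z = pair_prod_over J z * g z) /\
    ((forall j, a <> even_pole j) -> GammaTilde a = pair_prod_over J a * g a) /\
    holomorphic_at g a /\ g a <> 0 /\
    (forall j, a = even_pole j -> (j <= J)%nat).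
Proof.
  pose proof (Cmod_ge_0 a) as Ha0.
  set (r := (Cmod a + 1)%R).
  assert (Ha : (Cmod a < r)%R) by (unfold r; lra).
  destruct (exists_tail_index r) as [J HJ].
  assert (Hr : (0 <= r)%R) by lra.
  exists J, (pair_lim J). split; [|split; [|split; [|split]]].
  - generalize (filter_and _ _ (locally'_of_locally _ _ (Cmod_lt_locally a r Ha))
                  (avoid_even_poles_locally' a J)).
    apply filter_imp. intros z [H1 H2]. now apply (GammaTilde_tail r).
  - intros Hp. now apply (GammaTilde_tail r).
  - unfold holomorphic_at. generalize (Cmod_lt_locally a r Ha).
    apply filter_imp. intros z Hz. now apply (pair_lim_differentiable r).
  - now apply (pair_lim_neq_0 r).
  - intros j Hj. apply INR_le. rewrite Hj in Ha. unfold even_pole in Ha.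
    rewrite Cmod_opp, Cmod_R, Rabs_pos_eq in Ha
      by (pose proof (pos_INR j); lra).
    pose proof (pos_INR j). lra.
Qed.

Lemma GammaTilde_pole (m : nat) : has_pole GammaTilde (even_pole m).
Proof.
  destruct (GammaTilde_local_form (even_pole m)) as (J & g & H1 & _ & H3 & H4 & H5).
  apply has_pole_ext with (fun z => pair_prod_over J z * g z).
  - revert H1. apply filter_imp. now intros z ->.
  - apply has_pole_mult; [|easy|easy]. now apply pair_prod_over_pole, H5.
Qed.

Lemma locally_of_locally' (a : C) (P : C -> Prop) :
  locally' a P -> P a -> locally a P.
Proof.
  intros H Ha. unfold locally', within in H. revert H. apply filter_imp.
  intros z Hz. destruct (Ceq_dec z a) as [->|E]; [easy|now apply Hz].
Qed.

Lemma GammaTilde_holomorphic (a : C) :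
  (forall j, a <> even_pole j) -> holomorphic_at GammaTilde a.
Proof.
  intros Ha.
  destruct (GammaTilde_local_form a) as (J & g & H1 & H2 & H3 & _).
  apply holomorphic_at_ext with (fun z => pair_prod_over J z * g z).
  - apply locally_of_locally'; [|symmetry; auto].
    revert H1. apply filter_imp. now intros z ->.
  - apply holomorphic_at_mult; [|easy].
    apply pair_prod_over_holomorphic. auto.
Qed.

Lemma GammaTilde_meromorphic : meromorphic GammaTilde.
Proof.
  intros a.
  destruct (Classical_Prop.classic (exists j, a = even_pole j)) as [[j ->]|H].
  - right. apply GammaTilde_pole.
  - left. apply GammaTilde_holomorphic. intros j E. apply H. now exists j.
Qed.

(** * Values at integers *)

Open Scope R_scope.

(** * Wallis integrals *)

Definition wallis (n : nat) : R := RInt (fun x => sin x ^ n) 0 (PI / 2).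

Lemma ex_RInt_sin_pow (n : nat) (a b : R) : ex_RInt (fun x => sin x ^ n) a b.
Proof.
  apply (ex_RInt_continuous (V := R_CompleteNormedModule)). intros x _.
  apply (ex_derive_continuous (V := R_NormedModule)). auto_derive. easy.
Qed.

Lemma wallis_rec (n : nat) :
  (INR n + 2) * wallis (S (S n)) = (INR n + 1) * wallis n.
Proof.
  (* Integration by parts in primitive form: by [cos^2 = 1 - sin^2], the derivative of [G] is
     [(n+2) sin^(n+2) - (n+1) sin^n], and [G] vanishes at both ends. *)
  set (G := fun x => - cos x * sin x ^ S n).
  assert (H : is_RInt
    (fun x => minus (scal (INR n + 2) (sin x ^ S (S n)))
                    (scal (INR n + 1) (sin x ^ n)))
    0 (PI / 2) (minus (G (PI / 2)) (G 0))).
  { apply (is_RInt_derive (V := R_CompleteNormedModule)).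
    - intros x _. unfold G. evar_last; [auto_derive; easy|].
      unfold minus, plus, opp, scal, mult; simpl.
      unfold mult; simpl.
      pose proof (sin2_cos2 x) as E. unfold Rsqr in E.
      change (match n with 0%nat => 1 | S _ => INR n + 1 end) with (INR (S n)).
      rewrite S_INR.
      apply Rminus_diag_uniq.
      transitivity (- (INR n + 1) * (sin x * sin x + cos x * cos x - 1)
                    * sin x ^ n); [ring|rewrite E; ring].
    - intros x _.
      apply (ex_derive_continuous (V := R_NormedModule)
               (fun x0 => (INR n + 2) * sin x0 ^ S (S n)
                          + - ((INR n + 1) * sin x0 ^ n))).
      auto_derive. easy. }
  assert (W : forall k, is_RInt (fun x => sin x ^ k) 0 (PI / 2) (wallis k)).
  { intros k. apply (RInt_correct (V := R_CompleteNormedModule)).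
    apply ex_RInt_sin_pow. }
  assert (K := is_RInt_minus _ _ _ _ _ _
    (is_RInt_scal _ _ _ (INR n + 2) _ (W (S (S n))))
    (is_RInt_scal _ _ _ (INR n + 1) _ (W n))).
  apply (is_RInt_unique (V := R_CompleteNormedModule)) in H.
  apply (is_RInt_unique (V := R_CompleteNormedModule)) in K.
  assert (E := eq_trans (eq_sym K) H). unfold G in E. rewrite cos_PI2, sin_0 in E.
  unfold minus, plus, opp, scal, mult in E; simpl in E.
  unfold mult in E; simpl in E. lra.
Qed.

Lemma wallis_0 : wallis 0 = PI / 2.
Proof.
  unfold wallis. simpl. rewrite RInt_const. unfold scal; simpl; unfold mult; simpl.
  lra.
Qed.

Lemma wallis_1 : wallis 1 = 1.
Proof.
  unfold wallis.
  assert (H : is_RInt (fun x => sin x ^ 1) 0 (PI / 2)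
                (minus (- cos (PI / 2)) (- cos 0))).
  { apply (is_RInt_derive (V := R_CompleteNormedModule) (fun x => - cos x)).
    - intros x _. auto_derive; [easy|]. ring.
    - intros x _. apply (ex_derive_continuous (V := R_NormedModule)).
      auto_derive. easy. }
  apply (is_RInt_unique (V := R_CompleteNormedModule)) in H.
  rewrite H, cos_PI2, cos_0.
  unfold minus, plus, opp; simpl. lra.
Qed.

Lemma wallis_decr (n : nat) : wallis (S n) <= wallis n.
Proof.
  pose proof PI_RGT_0. unfold wallis.
  apply RInt_le; [lra|apply ex_RInt_sin_pow|apply ex_RInt_sin_pow|].
  intros x Hx. simpl.
  assert (0 <= sin x) by (apply sin_ge_0; lra).
  pose proof (SIN_bound x). pose proof (pow_le (sin x) n). nra.
Qed.

Lemma wallis_pos (n : nat) : 0 < wallis n /\ 0 < wallis (S n).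
Proof.
  induction n.
  - rewrite wallis_0, wallis_1. pose proof PI_RGT_0. lra.
  - split; [easy|]. pose proof (wallis_rec n). pose proof (pos_INR n). nra.
Qed.

(** * The paired product at positive integers *)

Fixpoint real_pair_prod (n : nat) (x : R) : R :=
  match n with
  | O => 1
  | S m => real_pair_prod m x *
           (2 * INR (S m) * (2 * INR (S m) - 1 + x)
            / ((2 * INR (S m) - 1) * (2 * INR (S m) + x)))
  end.

Lemma is_lim_seq_1_minus_inv (k : R) :
  1 <= k -> is_lim_seq (fun n => 1 - / (2 * INR n + k)) 1.
Proof.
  intros Hk. replace 1 with (1 - 0) at 1 by ring.
  apply is_lim_seq_minus'; [apply is_lim_seq_const|].
  apply is_lim_seq_le_le with (fun _ => 0) (fun n => / (INR n + 1)).
  - intros n. pose proof (pos_INR n). split.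
    + left. apply Rinv_0_lt_compat. lra.
    + apply Rinv_le_contravar; lra.
  - apply is_lim_seq_const.
  - apply is_lim_seq_inv_INR_S.
Qed.

(** At [x = 1] the factors are Wallis's [(2j)^2 / ((2j-1)(2j+1))]. By [wallis_rec] each is the ratio
    of two consecutive quotients [wallis (2n+1) / wallis (2n)], and [PI / 2] normalises the initial
    one. *)
Lemma real_pair_prod_1 (n : nat) :
  real_pair_prod n 1 = PI / 2 * (wallis (2 * n + 1) / wallis (2 * n)).
Proof.
  induction n.
  - simpl (2 * 0)%nat. simpl (0 + 1)%nat.
    rewrite wallis_0, wallis_1. simpl. pose proof PI_RGT_0. field. lra.
  - cbn [real_pair_prod]. rewrite IHn.
    replace (2 * S n + 1)%nat with (S (S (2 * n + 1))) by lia.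
    rewrite double_S.
    pose proof (wallis_rec (2 * n + 1)) as H1.
    pose proof (wallis_rec (2 * n)) as H2.
    destruct (wallis_pos (2 * n)) as [P1 P2].
    destruct (wallis_pos (S (2 * n))) as [_ P3].
    rewrite plus_INR, mult_INR in H1. rewrite mult_INR in H2.
    simpl (INR 2) in *. simpl (INR 1) in *.
    pose proof (pos_INR n). rewrite S_INR.
    replace (wallis (S (S (2 * n + 1)))) with
      ((2 * INR n + 2) / (2 * INR n + 3) * wallis (2 * n + 1)).
    2:{ apply Rmult_eq_reg_l with (2 * INR n + 3); [|lra].
        transitivity ((2 * INR n + 1 + 1) * wallis (2 * n + 1));
          [field; lra|lra]. }
    replace (wallis (S (S (2 * n)))) with
      ((2 * INR n + 1) / (2 * INR n + 2) * wallis (2 * n)).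
    2:{ apply Rmult_eq_reg_l with (2 * INR n + 2); [|lra].
        transitivity ((2 * INR n + 1) * wallis (2 * n));
          [field; lra|lra]. }
    field. lra.
Qed.

Lemma is_lim_seq_real_pair_prod_1 :
  is_lim_seq (fun n => real_pair_prod n 1) (PI / 2).
Proof.
  apply is_lim_seq_ext with
    (fun n => PI / 2 * (wallis (2 * n + 1) / wallis (2 * n))).
  { intros n. symmetry. apply real_pair_prod_1. }
  replace (Finite (PI / 2)) with (Finite (PI / 2 * 1)) by (f_equal; ring).
  apply is_lim_seq_mult'; [apply is_lim_seq_const|].
  (* Monotonicity squeezes the quotient between [wallis (2n+2) / wallis (2n) = (2n+1)/(2n+2)] and
     1. *)
  apply is_lim_seq_le_le with (fun n => 1 - / (2 * INR n + 2)) (fun _ => 1).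
  - intros n. rewrite Nat.add_1_r.
    destruct (wallis_pos (2 * n)) as [P1 P2].
    pose proof (wallis_decr (2 * n)) as D1.
    pose proof (wallis_decr (S (2 * n))) as D2.
    pose proof (wallis_rec (2 * n)) as H2.
    rewrite mult_INR in H2. simpl (INR 2) in H2. pose proof (pos_INR n).
    split; apply Rmult_le_reg_r with (wallis (2 * n)); try easy;
      unfold Rdiv; rewrite Rmult_assoc, Rinv_l, ?Rmult_1_r by lra; [|lra].
    apply Rle_trans with (2 := D2). right.
    apply Rmult_eq_reg_l with (2 * INR n + 2); [|lra].
    transitivity ((2 * INR n + 1) * wallis (2 * n)); [field; lra|lra].
  - apply is_lim_seq_1_minus_inv. lra.
  - apply is_lim_seq_const.
Qed.

Lemma is_lim_seq_real_pair_prod_2 :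
  is_lim_seq (fun n => real_pair_prod n 2) 2.
Proof.
  (* At [x = 2] the product telescopes to [(2n+1)/(n+1)]. *)
  apply is_lim_seq_ext with (fun n => 2 * (1 - / (2 * INR n + 2))).
  { induction n; [simpl; field|]. cbn [real_pair_prod]. rewrite <- IHn.
    rewrite S_INR. pose proof (pos_INR n). field. lra. }
  replace (Finite 2) with (Finite (2 * 1)) by (f_equal; ring).
  apply is_lim_seq_mult'; [apply is_lim_seq_const|].
  apply is_lim_seq_1_minus_inv. lra.
Qed.

(** Adding 2 to [x] moves the factors [2j - 1 + x] and [2j + x] to the next index, so only boundary
    terms survive. This is the finite form of the functional equation, with a last factor that tends
    to 1. *)
Lemma real_pair_prod_shift (n : nat) (x : R) :
  0 < x ->
  real_pair_prod n (x + 2) =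
  real_pair_prod n x * ((x + 2) / (x + 1)) * (1 - / (2 * INR n + (x + 2))).
Proof.
  intros Hx. induction n; [simpl; field; lra|].
  cbn [real_pair_prod]. rewrite IHn, S_INR. pose proof (pos_INR n).
  field. lra.
Qed.

Lemma is_lim_seq_real_pair_prod_shift (x l : R) :
  0 < x -> is_lim_seq (fun n => real_pair_prod n x) l ->
  is_lim_seq (fun n => real_pair_prod n (x + 2)) (l * ((x + 2) / (x + 1))).
Proof.
  intros Hx Hl. rewrite <- (Rmult_1_r (l * _)).
  eapply is_lim_seq_ext.
  { intros n. symmetry. now apply real_pair_prod_shift. }
  apply is_lim_seq_mult'; [|apply is_lim_seq_1_minus_inv; lra].
  apply is_lim_seq_mult'; [easy|apply is_lim_seq_const].
Qed.

Lemma double_fact_pos (m : nat) : 0 < INR (double_fact m).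
Proof.
  enough (H : 0 < INR (double_fact m) /\ 0 < INR (double_fact (S m))) by apply H.
  induction m; [simpl; lra|]. split; [easy|].
  change (double_fact (S (S m))) with (S (S m) * double_fact m)%nat.
  rewrite mult_INR. apply Rmult_lt_0_compat; [apply lt_0_INR; lia|easy].
Qed.

Lemma double_fact_SS (m : nat) :
  INR (double_fact (S (S m))) = (INR m + 2) * INR (double_fact m).
Proof.
  change (double_fact (S (S m))) with (S (S m) * double_fact m)%nat.
  rewrite mult_INR, !S_INR. ring.
Qed.

(** The leading [INR (2 * m + 2)] is the [x] that the prefactor [1 / x] removes in
    [GammaTilde_RtoC]. *)
Lemma real_pair_prod_even (m : nat) :
  is_lim_seq (fun n => real_pair_prod n (INR (2 * m + 2)))
    (INR (2 * m + 2) *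
     (INR (double_fact (2 * m)) / INR (double_fact (2 * m + 1)))).
Proof.
  induction m.
  - simpl. replace ((1 + 1) * (1 / 1)) with 2 by field.
    apply is_lim_seq_real_pair_prod_2.
  - assert (Hp : 0 < INR (2 * m + 2)) by (apply lt_0_INR; lia).
    apply (is_lim_seq_real_pair_prod_shift _ _ Hp) in IHm.
    replace (2 * S m + 2)%nat with (S (S (2 * m + 2))) by lia.
    replace (2 * S m + 1)%nat with (S (S (2 * m + 1))) by lia.
    rewrite double_S, !double_fact_SS, 2!S_INR.
    replace (INR (2 * m + 2) + 1 + 1) with (INR (2 * m + 2) + 2) by ring.
    evar_last; [exact IHm|]. apply f_equal.
    pose proof (double_fact_pos (2 * m + 1)).
    rewrite !plus_INR in *. rewrite !mult_INR in *.
    simpl (INR 2) in *. simpl (INR 1) in *. field. lra.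
Qed.

Lemma real_pair_prod_odd (m : nat) :
  is_lim_seq (fun n => real_pair_prod n (INR (2 * m + 1)))
    (INR (2 * m + 1) *
     (INR (double_fact (2 * m - 1)) / INR (double_fact (2 * m)) * (PI / 2))).
Proof.
  induction m.
  - simpl. replace (1 * (1 / 1 * (PI / 2))) with (PI / 2) by field.
    apply is_lim_seq_real_pair_prod_1.
  - assert (Hp : 0 < INR (2 * m + 1)) by (apply lt_0_INR; lia).
    apply (is_lim_seq_real_pair_prod_shift _ _ Hp) in IHm.
    replace (2 * S m + 1)%nat with (S (S (2 * m + 1))) by lia.
    rewrite double_S, double_fact_SS, 2!S_INR.
    replace (INR (2 * m + 1) + 1 + 1) with (INR (2 * m + 1) + 2) by ring.
    assert (E : INR (double_fact (S (S (2 * m)) - 1)) =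
                (INR (2 * m + 1)) * INR (double_fact (2 * m - 1))).
    (* At [m = 0] the subtraction [2 * m - 1] truncates to 0, and both sides are 1, in accordance
       with [(-1)!! = 1]. *)
    { destruct m; [simpl; ring|].
      replace (S (S (2 * S m)) - 1)%nat with (S (S (2 * S m - 1))) by lia.
      rewrite double_fact_SS. f_equal. rewrite <- (plus_INR _ 2).
      f_equal. lia. }
    rewrite E.
    evar_last; [exact IHm|]. apply f_equal.
    pose proof (double_fact_pos (2 * m)).
    rewrite !plus_INR in *. rewrite !mult_INR in *.
    simpl (INR 2) in *. simpl (INR 1) in *. field. lra.
Qed.

Lemma pair_prod_RtoC (n : nat) (x : R) :
  0 < x -> pair_prod 0 n (RtoC x) = RtoC (real_pair_prod n x).
Proof.
  intros Hx. induction n; [easy|].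
  cbn [pair_prod real_pair_prod]. rewrite IHn, Nat.add_0_l.
  unfold pair_dev.
  assert (H1 : 1 <= INR (S n)) by (apply (le_INR 1); lia).
  set (t := INR (S n)) in *.
  rewrite <- RtoC_plus, <- RtoC_mult, <- RtoC_div, <- RtoC_plus, <- RtoC_mult.
  - f_equal. f_equal. field. lra.
  - apply Rmult_integral_contrapositive_currified; lra.
Qed.

Lemma GammaTilde_RtoC (x l : R) :
  0 < x -> is_lim_seq (fun n => real_pair_prod n x) (x * l) ->
  GammaTilde (RtoC x) = RtoC l.
Proof.
  intros Hx Hl.
  rewrite (GammaTilde_lim (RtoC x) (RtoC (x * l))).
  - rewrite RtoC_mult. field. apply RtoC_neq_0. lra.
  - intros k Hk _ E. rewrite <- RtoC_opp in E. apply RtoC_inj in E.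
    pose proof (pos_INR k). lra.
  - eapply Ccv_ext; [|apply (Ccv_RtoC _ _ Hl)].
    intros n. symmetry. now apply pair_prod_RtoC.
Qed.

(** The pair of index [m + 1] has the numerator factor [x + 2m + 1], which vanishes here, and every
    later partial product contains it. *)
Lemma pair_prod_odd_zero (m n : nat) :
  pair_prod 0 (S m + n) (- RtoC (INR (2 * m + 1))) = RtoC 0.
Proof.
  induction n.
  - rewrite Nat.add_0_r. cbn [pair_prod]. rewrite Nat.add_0_l.
    rewrite one_plus_pair_dev; [|lia|].
    + replace (- RtoC (INR (2 * m + 1)) + RtoC (2 * INR (S m) - 1))%C with (RtoC 0).
      * unfold Cdiv. ring.
      * rewrite S_INR, plus_INR, mult_INR, <- RtoC_opp, <- RtoC_plus.
        simpl. f_equal. ring.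
    + rewrite S_INR, plus_INR, mult_INR, <- RtoC_opp, <- RtoC_plus.
      apply RtoC_neq_0. simpl. lra.
  - rewrite Nat.add_succ_r. cbn [pair_prod]. rewrite IHn. ring.
Qed.

Lemma GammaTilde_neg_odd (m : nat) :
  GammaTilde (- RtoC (INR (2 * m + 1))) = RtoC 0.
Proof.
  rewrite (GammaTilde_lim _ (RtoC 0)).
  - ring.
  - intros k _ [j ->] E.
    rewrite <- !RtoC_opp in E. apply RtoC_inj in E.
    apply Ropp_eq_reg, INR_eq in E. lia.
  - apply (Ccv_incr_n _ _ (S m)).
    apply Ccv_ext with (fun _ => RtoC 0); [|apply Ccv_const].
    intros n. symmetry. apply pair_prod_odd_zero.
Qed.

Open Scope C_scope.

Theorem theorem2p14 :
  (* the product defining GammaTilde converges wherever all its factors are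
     defined, and GammaTilde is meromorphic on C *)
  (forall x : C,
     (forall k : nat, (1 <= k)%nat -> Nat.Even k -> x <> - RtoC (INR k)) ->
     Cprod_converges (Gamma_factor x)) /\
  meromorphic GammaTilde /\
  (* (1) and (2) *)
  (forall n : nat, (1 <= n)%nat ->
     ((Nat.Even n ->
         GammaTilde (RtoC (INR n)) =
         RtoC (double_factZ (Z.of_nat n - 2) / double_factZ (Z.of_nat n - 1))%R) /\
      (Nat.Odd n ->
         GammaTilde (RtoC (INR n)) =
         RtoC (double_factZ (Z.of_nat n - 2) / double_factZ (Z.of_nat n - 1)
               * (PI / 2))%R)) /\
     ((Nat.Even n -> has_pole GammaTilde (- RtoC (INR n))) /\
      (Nat.Odd n -> GammaTilde (- RtoC (INR n)) = 0))).
Proof.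
  split; [exact Cprod_Gamma_factor_converges|].
  split; [exact GammaTilde_meromorphic|].
  intros n Hn. unfold double_factZ.
  (* At [n = 1] both [Z.to_nat] of -1 and the truncated difference [1 - 2] are 0. *)
  replace (Z.to_nat (Z.of_nat n - 2)) with (n - 2)%nat by lia.
  replace (Z.to_nat (Z.of_nat n - 1)) with (n - 1)%nat by lia.
  assert (Hpos : (0 < INR n)%R) by (apply lt_0_INR; lia).
  split; split.
  - intros [j Hj]. apply GammaTilde_RtoC; [easy|].
    replace n with (2 * (j - 1) + 2)%nat by lia.
    replace (2 * (j - 1) + 2 - 2)%nat with (2 * (j - 1))%nat by lia.
    replace (2 * (j - 1) + 2 - 1)%nat with (2 * (j - 1) + 1)%nat by lia.
    apply real_pair_prod_even.
  - intros [j ->]. apply GammaTilde_RtoC; [easy|].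
    replace (2 * j + 1 - 2)%nat with (2 * j - 1)%nat by lia.
    replace (2 * j + 1 - 1)%nat with (2 * j)%nat by lia.
    apply real_pair_prod_odd.
  - intros [j ->]. rewrite mult_INR. apply (GammaTilde_pole j).
  - intros [j ->]. apply GammaTilde_neg_odd.
Qed.
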